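(* Let $g_1,\dots,g_m\in\mathbb{R}[x]=\mathbb{R}[x_1,\dots,x_n]$ be even polynomials such that $g_1=L-\|x\|_2^2$ for some $L>0$ and $g_m=1$. Let $S$ be the semialgebraic set $$S:=\{x\in\mathbb{R}^n : g_1(x)\ge 0,\dots,g_m(x)\ge 0\}.$$ Let $f\in\mathbb{R}[x]$ be an even polynomial that is nonnegative on $S$, and let $d_f:=\lfloor \deg(f)/2\rfloor+1$. Then the following statements hold: 1. For all $\varepsilon>0$, there exists $K_\varepsilon\in\mathbb{N}$ such that for all $k\in\mathbb{N}$ with $k\ge K_\varepsilon$, there exist sums of monomial squares $\sigma_1,\dots,\sigma_m$ with $\deg(\sigma_j g_j)\le 2(k+d_f)$ for $j=1,\dots,m$ and $$(1+\|x\|_2^2)^k\,(f+\varepsilon)=\sum_{j=1}^m\sigma_j g_j.$$ 2. If $S$ has nonempty interior, there exist positive constants $\bar c$ and $c$ depending on $f$ and $S$ such that for all $\varepsilon>0$, the conclusion of item 1 holds with $K_\varepsilon=\bar c\,\varepsilon^{-c}$; that is, for all $\varepsilon>0$ and all $k\in\mathbb{N}$ with $k\ge \bar c\,\varepsilon^{-c}$, there exist sums of monomial squares $\sigma_1,\dots,\sigma_m$ with $\deg(\sigma_j g_j)\le 2(k+d_f)$ for $j=1,\dots,m$ and $(1+\|x\|_2^2)^k(f+\varepsilon)=\sum_{j=1}^m\sigma_j g_j$.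
   Context: $\mathbb{N}$ denotes the nonnegative integers, and $\|x\|_2^2=x_1^2+\dots+x_n^2$. A polynomial $p\in\mathbb{R}[x_1,\dots,x_n]$ is called even if it is invariant under any variable sign flip, i.e. $p$ is unchanged when any single variable $x_i$ is replaced by $-x_i$. For $\alpha\in\mathbb{N}^n$, $x^\alpha=x_1^{\alpha_1}\cdots x_n^{\alpha_n}$. A monomial square is a polynomial of the form $(a x^\alpha)^2$ with $a\in\mathbb{R}$ and $\alpha\in\mathbb{N}^n$; a sum of monomial squares is a finite sum of such polynomials. The zero polynomial is a sum of monomial squares and is regarded as satisfying every upper bound on the degree. *)

(* Defs.v *)
(* mpoly must be imported before the analysis files: in the other order their
   notations clash. *)
From mathcomp Require Import all_boot all_order all_algebra.
From mathcomp Require Import mpoly.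
From mathcomp Require Import boolp classical_sets reals topology normedtype exp.

Set Implicit Arguments.
Unset Strict Implicit.
Unset Printing Implicit Defensive.

Import Order.TTheory GRing.Theory Num.Theory.
Import numFieldNormedType.Exports.

Local Open Scope classical_set_scope.
Local Open Scope ring_scope.

(* The substitution x_i |-> - x_i, all other variables being fixed. *)
Definition sign_flip (R : realType) (n : nat) (i : 'I_n) (p : {mpoly R[n]}) :
    {mpoly R[n]} :=
  p \mPo [tuple (if j == i then - 'X_j else 'X_j) | j < n].

Definition even_mpoly (R : realType) (n : nat) (p : {mpoly R[n]}) : Prop :=
  forall i : 'I_n, sign_flip i p = p.

Definition sqnorm (R : realType) (n : nat) : {mpoly R[n]} :=
  \sum_(i < n) 'X_i ^+ 2.

(* Total degree: msize is 1 + the degree for a nonzero polynomial, and 0 for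
   the zero polynomial, whose degree is thus 0 here. *)
Definition tdeg (R : realType) (n : nat) (p : {mpoly R[n]}) : nat :=
  (msize p).-1.

Definition monomial_square (R : realType) (n : nat) (p : {mpoly R[n]}) : Prop :=
  exists (a : R) (alpha : 'X_{1..n}), p = (a *: 'X_[alpha]) ^+ 2.

Definition sum_of_monomial_squares (R : realType) (n : nat)
    (p : {mpoly R[n]}) : Prop :=
  exists s : seq {mpoly R[n]},
    (forall q, q \in s -> monomial_square q) /\ p = \sum_(q <- s) q.

Definition semialg (R : realType) (n m : nat) (g : 'I_m -> {mpoly R[n]}) :
    set 'rV[R]_n :=
  [set x | forall j : 'I_m, 0 <= (g j).@[x ord0]].

Definition half_degS (R : realType) (n : nat) (f : {mpoly R[n]}) : nat :=
  (tdeg f %/ 2 + 1)%N.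

Definition certificate (R : realType) (n m : nat) (g : 'I_m -> {mpoly R[n]})
    (f : {mpoly R[n]}) (eps : R) (k : nat) : Prop :=
  exists sigma : 'I_m -> {mpoly R[n]},
    (forall j : 'I_m, sum_of_monomial_squares (sigma j)) /\
    (forall j : 'I_m, (tdeg (sigma j * g j) <= 2 * (k + half_degS f))%N) /\
    (1 + sqnorm R n) ^+ k * (f + eps%:MP) = \sum_(j < m) sigma j * g j.

(* Main.v *)
Require Import Defs.
From mathcomp Require Import all_boot all_order all_algebra.
From mathcomp Require Import mpoly.
From mathcomp Require Import ordered_qelim.
From mathcomp Require qe_rcf.
From mathcomp Require Import boolp classical_sets reals topology normedtype derive realfun exp.
From mathcomp Require Import ring lra zify.

(** Substitute y_i for x_i^2. The even polynomials become f = F(y) and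
    g_j = G_j(y), with F nonnegative where y >= 0 and all G_j >= 0, and a sum of
    monomial squares becomes a polynomial in y with nonnegative coefficients.
    Homogenize, with y_0 as new variable, and restrict to the standard simplex:
    on it S becomes the set T where all the G_j are nonnegative, which stays away
    from the face y_0 = 0 because the ball constraint is negative there. There
    F + eps y_0^D is positive on T, and away from T some G_j is negative, so for
    M large the penalized function

      H = F + eps y_0^D + M sum_j max(0, - G_j)^2
        = F + eps y_0^D - sum_j (M max(0, - G_j)) G_j

    is positive on the whole simplex ([penalty_lower_bound]). The functions
    M max(0, - G_j) are nonnegative and Lipschitz, and their Bernstein polynomials
    s_j have nonnegative coefficients. As in the proof of Pólya's theorem, the
    coefficients of

      (1 + y_1 + ... + y_n)^k (F + eps) - sum_j s_j G_j,

    divided by the multinomial coefficients of degree N = k + D, are the values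
    of H at the points g / N up to O(1/N) ([bernstein_approx_polyM]). So they are
    nonnegative for large N, this difference is an admissible multiplier of
    g_m = 1, and all the degrees are at most N ([cone_eventually]).

    For a polynomial dependence on 1 / eps, both M and the minimum of H must be
    controlled by powers of eps. This is a Łojasiewicz inequality: a point of the
    simplex where F <= - t violates some constraint by at least c t^a
    ([lojasiewicz]). It follows from quantifier elimination for real closed
    fields: the existence of such a point with violations at most s is a Boolean
    combination of polynomial sign conditions on (t, s), hence does not depend on
    s for 0 < s <= c t^a, and by compactness it fails for s small.

    Large values of eps are treated apart ([cone_archimedean]): F + eps then has a
    certificate without any factor, by repeated use of L - y_1 - ... - y_n. *)

Set Implicit Arguments.
Unset Strict Implicit.
Unset Printing Implicit Defensive.

Import Order.TTheory GRing.Theory Num.Theory.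
Import numFieldNormedType.Exports.

Local Open Scope classical_set_scope.
Local Open Scope ring_scope.

(** * Signs of bivariate polynomials and formulas on horns *)

(** The variables t, s, s' range over the thin horn 0 < s, s' <= c t^a above a
    small interval 0 < t <= c; the requirement c <= 1 makes horns stable under
    intersection. Polynomial sizes of horns are what turns qualitative facts
    about formulas into inequalities with a power of t. *)
Definition on_horn (R : realType) (P : R -> R -> R -> Prop) :=
  exists (c : R) (a : nat), 0 < c <= 1 /\
    forall t, 0 < t <= c -> forall s s',
      0 < s <= c * t ^+ a -> 0 < s' <= c * t ^+ a -> P t s s'.

Lemma on_horn_mono (R : realType) (P Q : R -> R -> R -> Prop) :
  (forall t s s', P t s s' -> Q t s s') -> on_horn P -> on_horn Q.
Proof.
move=> PQ [c [a [c01 H]]]; exists c, a; split=> // t tc s s' sc s'c.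
by apply: PQ; apply: H.
Qed.

Lemma on_horn_and (R : realType) (P Q : R -> R -> R -> Prop) :
  on_horn P -> on_horn Q -> on_horn (fun t s s' => P t s s' /\ Q t s s').
Proof.
move=> [c [a [/andP[c0 c1] H]]] [d [b [/andP[d0 d1] K]]].
exists (Num.min c d), (a + b)%N.
have m0 : 0 < Num.min c d by rewrite lt_min c0.
split; first by rewrite m0 ge_min c1.
move=> t /andP[t0]; rewrite le_min => /andP[tc td] s s' /andP[s0 sm] /andP[s0' sm'].
have t1 : t <= 1 by apply: le_trans c1.
have ha : Num.min c d * t ^+ (a + b) <= c * t ^+ a.
  apply: ler_pM => //; rewrite ?(ltW m0) ?exprn_ge0 ?(ltW t0) ?ge_min ?lexx //.
  by apply: ler_wiXn2l => //; rewrite ?(ltW t0) ?leq_addr.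
have hb : Num.min c d * t ^+ (a + b) <= d * t ^+ b.
  apply: ler_pM => //; rewrite ?(ltW m0) ?exprn_ge0 ?(ltW t0) ?ge_min ?lexx ?orbT //.
  by apply: ler_wiXn2l => //; rewrite ?(ltW t0) ?leq_addl.
split.
  by apply: H; rewrite ?t0 ?tc ?s0 ?s0' ?(le_trans sm) ?(le_trans sm').
by apply: K; rewrite ?t0 ?td ?s0 ?s0' ?(le_trans sm) ?(le_trans sm').
Qed.

Lemma poly_bounded01 (R : realType) (p : {poly R}) :
  exists2 B : R, 0 < B & forall t, 0 <= t <= 1 -> `|p.[t]| <= B.
Proof.
elim/poly_ind: p => [|p c [B B0 H]].
  by exists 1 => // t _; rewrite horner0 normr0.
exists (B + `|c|); first by rewrite ltr_wpDr.
move=> t t01; rewrite hornerMXaddC.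
apply: le_trans (ler_normD _ _) _; rewrite lerD2r normrM.
have /andP[t0 t1] := t01.
by rewrite (ger0_norm t0) -[B]mulr1 ler_pM ?normr_ge0 ?H ?t0.
Qed.

(** Near 0 a nonzero polynomial behaves like its lowest nonzero term. *)
Lemma poly_lower_bound0 (R : realType) (p : {poly R}) : p != 0 ->
  exists (c : R) (a : nat), 0 < c <= 1 /\
    forall t, 0 < t <= c -> c * t ^+ a <= `|p.[t]|.
Proof.
elim/poly_ind: p => [|p c IH]; first by rewrite eqxx.
have [-> pc|c0 _] := eqVneq c 0.
  have /IH [d [a [d01 H]]] : p != 0.
    by apply: contraNneq pc => ->; rewrite mul0r add0r.
  exists d, a.+1; split=> // t td; have /andP[t0 _] := td.
  rewrite hornerMXaddC addr0 normrM (ger0_norm (ltW t0)) exprSr mulrA.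
  by rewrite ler_wpM2r ?(ltW t0) // H.
have [B B0 H] := poly_bounded01 p.
have c0' : 0 < `|c| by rewrite normr_gt0.
pose d := Num.min (Num.min 1 (`|c| / 2)) (`|c| / (2 * B)).
exists d, 0%N; split.
  rewrite !lt_min !ge_min lexx ltr01 /=.
  by rewrite !divr_gt0 ?mulr_gt0.
move=> t /andP[t0]; rewrite !le_min expr0 mulr1 -andbA => /and3P[t1 _ tB].
have hp := H t; rewrite (ltW t0) t1 in hp; move/(_ isT): hp => hp.
apply: (@le_trans _ _ (`|c| / 2)); first by rewrite !ge_min lexx orbT.
have h2 : `|p.[t] * t| <= `|c| / 2.
  rewrite normrM (ger0_norm (ltW t0)).
  apply: le_trans (ler_wpM2r (ltW t0) hp) _.
  apply: le_trans (ler_wpM2l (ltW B0) tB) _.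
  suff -> : B * (`|c| / (2 * B)) = `|c| / 2 by [].
  by field; rewrite gt_eqF.
rewrite hornerMXaddC addrC.
have := lerB_normD c (p.[t] * t); move: h2; lra.
Qed.

Lemma bipoly_bounded01 (R : realType) (q : {poly {poly R}}) :
  exists2 B : R, 0 < B &
    forall t s, 0 <= t <= 1 -> 0 <= s <= 1 -> `|(q.[s%:P]).[t]| <= B.
Proof.
elim/poly_ind: q => [|p c [B B0 H]].
  by exists 1 => // t s _ _; rewrite !horner0 normr0.
have [C C0 HC] := poly_bounded01 c.
exists (B + C); first by rewrite addr_gt0.
move=> t s t01 s01; rewrite hornerMXaddC hornerD hornerM hornerC.
apply: le_trans (ler_normD _ _) _; apply: lerD (HC _ t01); rewrite normrM.
have /andP[s0 s1] := s01.
by rewrite (ger0_norm s0) -[B]mulr1 ler_pM ?normr_ge0 ?H ?s0.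
Qed.

(** View q as a polynomial in s with coefficients in R[t]. Its lowest nonzero
    coefficient is at least c t^a in absolute value for small t, so it
    dominates all the higher terms as soon as s is a small multiple of t^a:
    the sign of q does not depend on s in such a horn. *)
Lemma on_horn_sgr_bipoly (R : realType) (q : {poly {poly R}}) :
  on_horn (fun t s s' : R => Num.sg (q.[s%:P]).[t] = Num.sg (q.[s'%:P]).[t]).
Proof.
elim/poly_ind: q => [|p c IH].
  by exists 1, 0%N; split=> [|*]; rewrite ?ltr01 ?lexx // !horner0.
have [->|c0] := eqVneq c 0.
  have [d [a [d01 H]]] := IH; exists d, a; split=> // t td s s' sd s'd.
  rewrite !hornerMXaddC !addr0 !hornerM !hornerC !sgrM.
  have /andP[s0 _] := sd; have /andP[s0' _] := s'd.
  by rewrite (gtr0_sg s0) (gtr0_sg s0') !mulr1; apply: H.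
have [B B0 H] := bipoly_bounded01 p.
have [d [a [/andP[d0 d1] K]]] := poly_lower_bound0 c0.
have hBd : d / (B + 1) <= d by rewrite ler_pdivrMr ?ler_peMr ?(ltW d0) ?addr_gt0 ?lerDr ?(ltW B0).
exists (d / (B + 1)), a; split.
  by rewrite divr_gt0 ?addr_gt0 ?(le_trans hBd).
move=> t /andP[t0 td] s s' sd s'd.
have td' : t <= d by apply: le_trans hBd.
have t1 : t <= 1 by apply: le_trans d1.
suff E r : 0 < r <= d / (B + 1) * t ^+ a ->
    Num.sg ((p * 'X + c%:P).[r%:P]).[t] = Num.sg c.[t] by rewrite !E.
move=> /andP[r0 rd].
rewrite hornerMXaddC hornerD hornerM hornerC.
have ct : d * t ^+ a <= `|c.[t]| by apply: K; rewrite t0.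
have ta1 : 0 <= t ^+ a <= 1 by rewrite exprn_ge0 ?exprn_ile1 ?(ltW t0).
have r1 : r <= 1.
  apply: le_trans rd _; apply: mulr_ile1; rewrite ?(le_trans hBd) ?divr_ge0 //; try lra.
have hp : `|p.[r%:P].[t]| <= B by apply: H; rewrite ?(ltW t0) ?(ltW r0).
have hlt : `|p.[r%:P].[t] * r| < `|c.[t]|.
  rewrite normrM (ger0_norm (ltW r0)).
  apply: (@lt_le_trans _ _ ((B + 1) * r)).
    by rewrite ltr_pM2r //; lra.
  apply: le_trans ct; rewrite -ler_pdivlMl ?addr_gt0 //.
  by rewrite mulrA [_^-1 * _]mulrC.
case: (ltgtP c.[t] 0) hlt => [h|h|->]; last by rewrite normr0 ltNge normr_ge0.
  rewrite (ltr0_norm h) ltr_norml => /andP[_ h']; rewrite !ltr0_sg //; lra.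
rewrite (gtr0_norm h) ltr_norml => /andP[h' _]; rewrite !gtr0_sg //; lra.
Qed.

(** In the outer variable sits s, and the coefficients are polynomials in t. *)
Lemma rterm_bipoly (R : realType) (u : GRing.term R) : GRing.rterm u ->
  exists q : {poly {poly R}},
    forall t s, GRing.eval [:: t; s] u = (q.[s%:P]).[t].
Proof.
elim: u => //=.
- move=> i _; exists (if i == 0%N then 'X%:P else if i == 1%N then 'X else 0).
  move=> t s; case: i => [|[|i]] /=; rewrite ?hornerC ?hornerX ?hornerC ?horner0 //.
  by rewrite nth_nil.
- by move=> r _; exists r%:P%:P => t s; rewrite !hornerC.
- by move=> k _; exists k%:R => t s; rewrite -!polyC_natr !hornerC.
- move=> u IHu v IHv /andP[/IHu[p Hp] /IHv[q Hq]]; exists (p + q) => t s.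
  by rewrite !hornerD Hp Hq.
- by move=> u IHu /IHu[p Hp]; exists (- p) => t s; rewrite !hornerN Hp.
- by move=> u IHu k /IHu[p Hp]; exists (p *+ k) => t s; rewrite !hornerMn Hp.
- move=> u IHu v IHv /andP[/IHu[p Hp] /IHv[q Hq]]; exists (p * q) => t s.
  by rewrite !hornerM Hp Hq.
- by move=> u IHu k /IHu[p Hp]; exists (p ^+ k) => t s; rewrite !horner_exp Hp.
Qed.

Lemma on_horn_sgr_rterm (R : realType) (u v : GRing.term R) :
  GRing.rterm u -> GRing.rterm v ->
  on_horn (fun t s s' : R =>
    Num.sg (GRing.eval [:: t; s] u - GRing.eval [:: t; s] v) =
    Num.sg (GRing.eval [:: t; s'] u - GRing.eval [:: t; s'] v)).
Proof.
move=> /rterm_bipoly[p Hp] /rterm_bipoly[q Hq].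
apply: on_horn_mono (on_horn_sgr_bipoly (p - q)) => t s s'.
by rewrite !Hp !Hq !hornerD !hornerN.
Qed.

Lemma on_horn_qf_eval (R : realType) (f : ord.formula R) :
  ord.qf_form f -> ord.rformula f ->
  on_horn (fun t s s' : R => ord.qf_eval [:: t; s] f = ord.qf_eval [:: t; s'] f).
Proof.
elim: f => //=.
- by move=> b _ _; exists 1, 0%N; rewrite ltr01 lexx.
- move=> u v _ /andP[ru rv]; apply: on_horn_mono (on_horn_sgr_rterm ru rv) => t s s' E.
  by rewrite -subr_eq0 -sgr_eq0 E sgr_eq0 subr_eq0.
- move=> u v _ /andP[ru rv]; apply: on_horn_mono (on_horn_sgr_rterm ru rv) => t s s' E.
  by rewrite -subr_lt0 -sgr_lt0 E sgr_lt0 subr_lt0.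
- move=> u v _ /andP[ru rv]; apply: on_horn_mono (on_horn_sgr_rterm ru rv) => t s s' E.
  by rewrite -subr_le0 -sgr_le0 E sgr_le0 subr_le0.
- move=> f IHf g IHg /andP[qf qg] /andP[rf rg].
  by apply: on_horn_mono (on_horn_and (IHf qf rf) (IHg qg rg)) => t s s' [-> ->].
- move=> f IHf g IHg /andP[qf qg] /andP[rf rg].
  by apply: on_horn_mono (on_horn_and (IHf qf rf) (IHg qg rg)) => t s s' [-> ->].
- move=> f IHf g IHg /andP[qf qg] /andP[rf rg].
  by apply: on_horn_mono (on_horn_and (IHf qf rf) (IHg qg rg)) => t s s' [-> ->].
- by move=> f IHf qf rf; apply: on_horn_mono (IHf qf rf) => t s s' ->.
Qed.

(** By quantifier elimination over real closed fields, the truth of any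
    first-order formula in t and s is a Boolean combination of signs of
    polynomials, hence constant in s on a horn. *)
Lemma on_horn_holds (R : realType) (f : ord.formula R) : ord.rformula f ->
  on_horn (fun t s s' : R => ord.holds [:: t; s] f -> ord.holds [:: t; s'] f).
Proof.
move=> rf.
have wf := @qe_rcf.wf_QE_wproj R; have valid := @qe_rcf.valid_QE_wproj R.
have /andP[qqf rqf] := ord.quantifier_elim_wf wf rf.
apply: on_horn_mono (on_horn_qf_eval qqf rqf) => t s s' E.
move=> /(ord.quantifier_elim_rformP wf valid _ rf) h.
by apply/(ord.quantifier_elim_rformP wf valid _ rf); rewrite -E.
Qed.

(** Variables 0, ..., size e - 1 are the parameters, and the n quantified ones
    come next. *)
Lemma holds_existsn (R : realType) (f : ord.formula R) n e :
  ord.holds e (foldr (@ord.Exists R) f (iota (size e) n)) <->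
  exists w : n.-tuple R, ord.holds (e ++ w) f.
Proof.
elim: n e => [|n IH] e /=.
  split=> [h|[w]]; last by rewrite tuple0 cats0.
  by exists [tuple]; rewrite cats0.
have E x : set_nth 0 e (size e) x = rcons e x.
  by elim: e => //= y e' ->.
split=> [[x]|[w]].
  rewrite E -(size_rcons e x) => /IH[w h]; exists [tuple of x :: w].
  by rewrite /= -cat_rcons.
case/tupleP: w => x w /= h; exists x; rewrite E -(size_rcons e x).
by apply/IH; exists w; rewrite cat_rcons.
Qed.

Lemma rformula_existsn (R : realType) (f : ord.formula R) (l : seq nat) :
  ord.rformula f -> ord.rformula (foldr (@ord.Exists R) f l).
Proof. by elim: l. Qed.

(** * A Łojasiewicz inequality *)

Lemma mpoly_rterm (R : realType) (n : nat) (p : {mpoly R[n]}) :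
  exists2 u : GRing.term R, GRing.rterm u &
    forall t s (w : n.-tuple R), GRing.eval [:: t, s & w] u = p.@[tnth w].
Proof.
have prodP (m : 'X_{1..n}) (l : seq 'I_n) :
    exists2 u : GRing.term R, GRing.rterm u &
      forall t s (w : n.-tuple R),
        GRing.eval [:: t, s & w] u = \prod_(i <- l) tnth w i ^+ m i.
  elim: l => [|i l [u ru Hu]].
    by exists (GRing.Const 1) => // t s w; rewrite big_nil.
  exists (GRing.Mul (GRing.Exp (GRing.Var R i.+2) (m i)) u) => //= t s w.
  by rewrite big_cons Hu (tnth_nth 0).
elim/mpolyind: p => [|c m p _ _ [u ru Hu]].
  by exists (GRing.Const 0) => // t s w; rewrite meval0.
have [v rv Hv] := prodP m (index_enum 'I_n).
exists (GRing.Add (GRing.Mul (GRing.Const c) v) u) => /=.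
  by rewrite rv ru.
by move=> t s w; rewrite Hu Hv mevalD mevalZ mevalX.
Qed.

(** Solvability in u of a system of polynomial inequalities that depends
    affinely on two parameters t and s is a first-order property of (t, s). *)
Lemma on_horn_exists_system (R : realType) (n : nat)
    (cs : seq ({mpoly R[n]} * R * R)) (A := fun t s : R =>
      exists u : 'I_n -> R,
        forall c, c \in cs -> 0 <= c.1.1.@[u] + c.1.2 * t + c.2 * s) :
  on_horn (fun t s s' => A t s -> A t s').
Proof.
have [f [rf Hf]] : exists f : ord.formula R, ord.rformula f /\
    forall t s (w : n.-tuple R), ord.holds [:: t, s & w] f <->
      (forall c, c \in cs -> 0 <= c.1.1.@[tnth w] + c.1.2 * t + c.2 * s).
  elim: cs @A => [|c l IH] _; first by exists (ord.Bool true).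
  have [f [rf Hf]] := IH.
  have [u ru Hu] := mpoly_rterm c.1.1.
  exists (ord.And (ord.Le (GRing.Const 0)
     (GRing.Add (GRing.Add u (GRing.Mul (GRing.Const c.1.2) (GRing.Var R 0)))
        (GRing.Mul (GRing.Const c.2) (GRing.Var R 1)))) f).
  split=> [|t s w] /=; first by rewrite ru rf.
  rewrite Hu Hf; split=> [[h1 h2] d|h].
    by rewrite inE => /orP[/eqP->|/h2].
  by split=> [|d dl]; apply: h; rewrite inE ?eqxx ?dl ?orbT.
apply: on_horn_mono (on_horn_holds (rformula_existsn (iota 2 n) rf)) => t s s' h.
have HA r : A t r <-> ord.holds [:: t; r] (foldr (@ord.Exists R) f (iota 2 n)).
  rewrite (holds_existsn f n [:: t; r]) /=; split=> [[u Hu]|[w /Hf hw]].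
    exists [tuple u i | i < n]; apply/Hf => c /Hu.
    by rewrite (@meval_eq _ _ _ u) // => i; rewrite tnth_mktuple.
  by exists (tnth w).
by rewrite !HA.
Qed.

Lemma meval_continuous (R : realType) (n : nat) (p : {mpoly R[n]}) :
  continuous (fun x : 'rV[R]_n => p.@[x ord0]).
Proof.
elim/mpolyind: p => [|c m p _ _ IH].
  rewrite (_ : (fun x : 'rV[R]_n => _) = (fun=> 0)); first exact: cst_continuous.
  by apply/funext => y; rewrite meval0.
rewrite (_ : (fun x : 'rV[R]_n => _) =
    (fun x : 'rV[R]_n => c * (\prod_(i < n) x ord0 i ^+ m i) + p.@[x ord0])); last first.
  by apply/funext => y; rewrite mevalD mevalZ mevalX.
move=> x; apply: (@continuousD R R^o _ (fun x : 'rV[R]_n => c * (\prod_(i < n) x ord0 i ^+ m i))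
  (fun x : 'rV[R]_n => p.@[x ord0])); last exact: IH.
apply: continuousM; first exact: cst_continuous.
apply: (@continuous_big R _ *%R 1 xpredT _ _ (index_enum 'I_n)
  (fun i (y : 'rV[R]_n) => y ord0 i ^+ m i)).
  exact: mul_continuous.
move=> i _ y; apply: (@continuous_comp _ _ _ (fun z : 'rV[R]_n => z ord0 i)
   (fun z : R => z ^+ m i)); first exact: coord_continuous.
exact: exprn_continuous.
Qed.

(** The sum of the violations max(0, - q_i) is continuous and positive, so it
    has a positive minimum on K; everywhere on K some term exceeds a fixed
    fraction of this minimum. *)
Lemma compact_violation (R : realType) (n : nat) (I : finType)
    (K : set 'rV[R]_n) (q : I -> {mpoly R[n]}) :
  compact K ->
  (forall x, K x -> exists i, (q i).@[x ord0] < 0) ->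
  exists2 s : R, 0 < s & forall x, K x -> exists i, (q i).@[x ord0] < - s.
Proof.
move=> cK hK.
have [/eqP K0|/set0P K0] := boolP (K == set0).
  by exists 1 => // x; rewrite K0.
pose h (x : 'rV[R]_n) := \sum_i Num.max 0 (- (q i).@[x ord0]).
have hcont : continuous h.
  apply: (@continuous_big R _ +%R 0 xpredT _ _ (index_enum I)
    (fun i (y : 'rV[R]_n) => Num.max 0 (- (q i).@[y ord0]))).
    exact: add_continuous.
  move=> i _ y; apply: (@continuous_max R _ (fun=> 0)
    (fun y : 'rV[R]_n => - (q i).@[y ord0])); first exact: cst_continuous.
  by apply: (@continuousN R R^o); exact: meval_continuous.
have [x0 x0K hmin] := compact_EVT_min K0 cK (continuous_subspaceT hcont).
rewrite inE in x0K.
have hge0 i x : 0 <= Num.max 0 (- (q i).@[x ord0]) by rewrite le_max lexx.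
have h0 : 0 < h x0.
  have [i qi] := hK _ x0K; rewrite /h (bigD1 i) //=.
  rewrite ltr_pwDl ?sumr_ge0 // lt_max oppr_gt0 qi orbT //.
pose s := h x0 / (#|I|.+1%:R).
exists s => [|x xK]; first by rewrite divr_gt0.
apply: contrapT => hn.
have hle i : Num.max 0 (- (q i).@[x ord0]) <= s.
  rewrite ge_max divr_ge0 ?(ltW h0) //=.
  by rewrite lerNl leNgt; apply/negP => hi; apply: hn; exists i.
have := hmin x; rewrite inE => /(_ xK); apply/negP; rewrite -ltNge.
apply: (@le_lt_trans _ _ (\sum_(i : I) s)); first exact: ler_sum.
rewrite sumr_const -mulr_natr /s mulrAC -mulrA.
by rewrite gtr_pMr // ltr_pdivrMr // mul1r ltr_nat.
Qed.

(** A Łojasiewicz inequality: the constraints q_i are violated at least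
    polynomially in the amount by which p fails to be nonnegative.
    Let A t s say that some u in K has p(u) <= - t and q_i(u) >= - s for all i.
    For every t > 0, compactness makes A t s false for some s > 0, and truth of
    A t s does not depend on s on a horn; so A is false on the whole horn. *)
Lemma lojasiewicz (R : realType) (n : nat) (I : finType) (p : {mpoly R[n]})
    (q : I -> {mpoly R[n]}) (rs : seq {mpoly R[n]}) :
  compact [set x : 'rV[R]_n | forall r, r \in rs -> 0 <= r.@[x ord0]] ->
  (forall u : 'I_n -> R, (forall r, r \in rs -> 0 <= r.@[u]) ->
     (forall i, 0 <= (q i).@[u]) -> 0 <= p.@[u]) ->
  exists (c : R) (a : nat), 0 < c /\ forall t, 0 < t <= 1 ->
    forall u : 'I_n -> R, (forall r, r \in rs -> 0 <= r.@[u]) ->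
      p.@[u] <= - t -> exists i, (q i).@[u] < - (c * t ^+ a).
Proof.
move=> cK hp.
pose cs : seq ({mpoly R[n]} * R * R) :=
  (- p, -1, 0) :: [seq (r, 0, 0) | r <- rs] ++ [seq (q i, 0, 1) | i <- enum I].
pose A t s := exists u : 'I_n -> R,
  forall c, c \in cs -> 0 <= c.1.1.@[u] + c.1.2 * t + c.2 * s.
have AE t s : A t s <-> exists u : 'I_n -> R,
    [/\ forall r, r \in rs -> 0 <= r.@[u], p.@[u] <= - t &
        forall i, - s <= (q i).@[u]].
  split=> -[u hu]; exists u.
    split=> [r rrs||i].
    - have /hu : (r, 0, 0) \in cs by rewrite inE mem_cat map_f ?orbT.
      by rewrite /= !mul0r !addr0.
    - have /hu : (- p, -1, 0) \in cs by rewrite inE eqxx.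
      by rewrite /= mevalN; lra.
    - have /hu : (q i, 0, 1) \in cs.
        by rewrite inE mem_cat (map_f (fun i => (q i, 0, 1))) ?mem_enum ?orbT.
      by rewrite /=; lra.
  case: hu => h1 h2 h3 c; rewrite inE mem_cat => /or3P[/eqP->|/mapP[r rrs ->]|/mapP[i _ ->]] /=.
  - by rewrite mevalN; move: h2; lra.
  - by rewrite !mul0r !addr0; exact: h1.
  - by have := h3 i; lra.
have A_s t s s' : s <= s' -> A t s -> A t s'.
  move=> ss' /AE[u [h1 h2 h3]]; apply/AE; exists u; split=> // i.
  by apply: le_trans (h3 i); rewrite lerN2.
have A_t t t' s : t' <= t -> A t s -> A t' s.
  move=> ss' /AE[u [h1 h2 h3]]; apply/AE; exists u; split=> //.
  by apply: le_trans h2 _; rewrite lerN2.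
have A_small t : 0 < t -> exists2 s, 0 < s & ~ A t s.
  move=> t0.
  pose K := [set x : 'rV[R]_n | forall r, r \in rs -> 0 <= r.@[x ord0]]
     `&` (fun x : 'rV[R]_n => p.@[x ord0]) @^-1` [set y | y <= - t].
  have cKt : compact K.
    apply: compact_closedI => //; have /continuous_closedP := @meval_continuous R n p; apply; exact: closed_le.
  have [x [hx1 hx2]|s s0 hs] := compact_violation cKt (q := q).
    apply: contrapT => hn.
    have : 0 <= p.@[x ord0].
      by apply: hp => // i; rewrite leNgt; apply/negP => hi; apply: hn; exists i.
    by move: hx2 => /=; lra.
  exists s => // /AE[u [h1 h2 h3]].
  have E r : r.@[(\row_i u i) ord0] = r.@[u] by apply: meval_eq => i; rewrite mxE.
  have [|i] := hs (\row_i u i).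
    by split=> [r rrs|] /=; rewrite ?E //; exact: h1.
  by rewrite E; have := h3 i; lra.
have [c [a [/andP[c0 c1] H]]] := on_horn_exists_system cs.
have notA t s : 0 < t <= c -> 0 < s <= c * t ^+ a -> ~ A t s.
  move=> tc sc hA; have /andP[t0 _] := tc.
  have [s' s'0 hn] := A_small t t0; apply: hn.
  have m0 : 0 < Num.min s' (c * t ^+ a).
    by rewrite lt_min s'0 mulr_gt0 ?exprn_gt0.
  apply: (A_s _ (Num.min s' (c * t ^+ a))); first by rewrite ge_min lexx.
  by apply: H hA => //; rewrite m0 ge_min lexx orbT.
(* The horn only concerns t <= c; the factor c^(a+1) in place of c covers
   c < t <= 1 by comparison with t = c. *)
exists (c ^+ a.+1), a; split=> [|t /andP[t0 t1] u hu hpu]; first exact: exprn_gt0.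
apply: contrapT => hn.
have sA : A t (c ^+ a.+1 * t ^+ a).
  apply/AE; exists u; split=> // i.
  by rewrite leNgt; apply/negP => hi; apply: hn; exists i.
have s0 : 0 < c ^+ a.+1 * t ^+ a by rewrite mulr_gt0 ?exprn_gt0.
have ca1 : c ^+ a <= 1 by rewrite exprn_ile1 ?(ltW c0).
have ta1 : t ^+ a <= 1 by rewrite exprn_ile1 ?(ltW t0).
have [tc|ct] := leP t c.
  apply: notA sA; rewrite ?t0 // s0 exprS -mulrA ler_pM2l //=.
  by rewrite ler_piMl // exprn_ge0 ?(ltW t0).
apply: (notA c (c ^+ a.+1 * t ^+ a)); rewrite ?c0 ?lexx //.
  rewrite s0 exprS -mulrA ler_pM2l //= ler_piMr // exprn_ge0 ?(ltW c0) //.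
by apply: A_t sA; exact: ltW.
Qed.

(** * Multinomial weights *)

(** The polynomial 1 + |x|^2 after the substitution of x_i^2 by y_i. It is the
    dehomogenization of y_0 + y_1 + ... + y_n. *)
Definition simplex_form (R : realType) (n : nat) : {mpoly R[n]} :=
  1 + \sum_(i < n) 'X_i.

(** These are the multinomial coefficients N! / (g! (N - |g|)!). Being defined
    as coefficients of a power, they are nonnegative for free and vanish when
    |g| > N. *)
Definition weight (R : realType) (n N : nat) (g : 'X_{1..n}) : R :=
  (simplex_form R n ^+ N)@_g.

Definition coef_ge0 (R : realType) (n : nat) (p : {mpoly R[n]}) : Prop :=
  forall g, 0 <= p@_g.

Lemma coef_ge0D (R : realType) (n : nat) (p q : {mpoly R[n]}) :
  coef_ge0 p -> coef_ge0 q -> coef_ge0 (p + q).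
Proof. by move=> hp hq g; rewrite mcoeffD addr_ge0. Qed.

Lemma coef_ge0Z (R : realType) (n : nat) c (p : {mpoly R[n]}) :
  0 <= c -> coef_ge0 p -> coef_ge0 (c *: p).
Proof. by move=> hc hp g; rewrite mcoeffZ mulr_ge0. Qed.

Lemma coef_ge0X (R : realType) (n : nat) m : coef_ge0 ('X_[m] : {mpoly R[n]}).
Proof. by move=> g; rewrite mcoeffX ler0n. Qed.

Lemma coef_ge0M (R : realType) (n : nat) (p q : {mpoly R[n]}) :
  coef_ge0 p -> coef_ge0 q -> coef_ge0 (p * q).
Proof.
by move=> hp hq g; rewrite mcoeffM sumr_ge0 // => k _; rewrite mulr_ge0.
Qed.

Lemma coef_ge0_1 (R : realType) (n : nat) : coef_ge0 (1 : {mpoly R[n]}).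
Proof. by move=> g; rewrite mcoeff1 ler0n. Qed.

Lemma coef_ge0_0 (R : realType) (n : nat) : coef_ge0 (0 : {mpoly R[n]}).
Proof. by move=> g; rewrite mcoeff0. Qed.

Lemma coef_ge0_sum (R : realType) (n : nat) (I : Type) (r : seq I) (P : pred I)
    (F : I -> {mpoly R[n]}) :
  (forall i, P i -> coef_ge0 (F i)) -> coef_ge0 (\sum_(i <- r | P i) F i).
Proof.
move=> h; elim/big_ind: _ => //; [exact: coef_ge0_0|exact: coef_ge0D].
Qed.

Lemma coef_ge0_exp (R : realType) (n : nat) (p : {mpoly R[n]}) k :
  coef_ge0 p -> coef_ge0 (p ^+ k).
Proof.
by move=> hp; elim: k => [|k IH]; rewrite ?exprS;
  [exact: coef_ge0_1|exact: coef_ge0M].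
Qed.

Lemma coef_ge0_simplex (R : realType) (n : nat) : coef_ge0 (simplex_form R n).
Proof.
apply: coef_ge0D; first exact: coef_ge0_1.
by apply: coef_ge0_sum => i _; exact: coef_ge0X.
Qed.

Lemma weight_ge0 (R : realType) (n N : nat) (g : 'X_{1..n}) : 0 <= weight R N g :> R.
Proof. by apply: coef_ge0_exp; exact: coef_ge0_simplex. Qed.

Lemma mcoeff_XM (R : realType) (n : nat) (i : 'I_n) (p : {mpoly R[n]})
    (g : 'X_{1..n}) :
  ('X_i * p)@_(g + U_(i)) = p@_g.
Proof. by rewrite mulrC addmC mcoeffMX. Qed.

Lemma mcoeff_XM0 (R : realType) (n : nat) (i : 'I_n) (p : {mpoly R[n]})
    (g : 'X_{1..n}) :
  g i = 0%N -> ('X_i * p)@_g = 0.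
Proof.
move=> gi; apply: memN_msupp_eq0; rewrite mulrC.
rewrite (perm_mem (msuppMX p U_(i))); apply/mapP => -[h _ E].
by move: gi; rewrite E mnmDE mnm1E eqxx.
Qed.

Lemma mnm_predU (n : nat) (i : 'I_n) (g : 'X_{1..n}) : g i != 0%N ->
  exists h, g = (h + U_(i))%MM.
Proof. by rewrite -lep1mP => le; exists (g - U_(i))%MM; rewrite submK. Qed.

Lemma deriv_simplex_form (R : realType) (n N : nat) (i : 'I_n) :
  (simplex_form R n ^+ N.+1)^`M(i) = N.+1%:R *: simplex_form R n ^+ N.
Proof.
have D1 : (simplex_form R n)^`M(i) = 1.
  rewrite /simplex_form mderivD -mpolyC1 mderivC add0r raddf_sum /=.
  rewrite (bigD1 i) //= big1 => [|j ji]; rewrite mderivX ?mnm1E ?eqxx ?(negPf ji) ?scale0r //.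
  by rewrite scale1r addr0 (_ : U_(i) - U_(i) = 0)%MM ?mpolyX0 ?mpolyC1 //;
     apply/mnmP=> j; rewrite mnmBE mnm0E subnn.
elim: N => [|N IH]; first by rewrite expr1 expr0 D1 scale1r.
rewrite exprS mderivM D1 mul1r IH -scalerAr -exprS.
by rewrite -{1}[_ ^+ _]scale1r -scalerDl -[in RHS]natr1 addrC.
Qed.

(** The derivative of the N.+1-st power, read coefficientwise. *)
Lemma weightXU (R : realType) (n N : nat) (i : 'I_n) (g : 'X_{1..n}) :
  N.+1%:R * weight R N g = (g i).+1%:R * weight R N.+1 (g + U_(i)).
Proof.
have := congr1 (mcoeff g) (deriv_simplex_form R N i).
by rewrite mcoeff_deriv mcoeffZ /weight => <-; rewrite mulr_natl.
Qed.

(** Euler's identity: sum the relations coming from all the derivatives. This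
    is the recurrence for the homogenizing variable, whose exponent is
    N.+1 - |g|. *)
Lemma weight1 (R : realType) (n N : nat) (g : 'X_{1..n}) :
  N.+1%:R * weight R N g = (N.+1%:R - (mdeg g)%:R) * weight R N.+1 g.
Proof.
have H i : N.+1%:R * ('X_i * simplex_form R n ^+ N)@_g = (g i)%:R * weight R N.+1 g.
  have [gi|/mnm_predU[h ->]] := eqVneq (g i) 0%N.
    by rewrite mcoeff_XM0 // gi mulr0 mul0r.
  by rewrite mcoeff_XM -/(weight R N h) (weightXU R N i) mnmDE mnm1E eqxx addn1.
rewrite mulrBl mdegE natr_sum mulr_suml -(eq_bigr _ (fun i _ => H i)).
rewrite /weight [in RHS]exprS mulrDl mul1r mcoeffD mulr_suml raddf_sum /= mulrDr.
by rewrite mulr_sumr addrK.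
Qed.

(** Otherwise the right-hand side of Euler's identity would be nonpositive and
    the left-hand side positive. *)
Lemma weight_eq0 (R : realType) (n N : nat) (g : 'X_{1..n}) :
  (N < mdeg g)%N -> weight R N g = 0.
Proof.
move=> Ng; have := weight1 R N g.
apply: contra_eq => w0; have w : 0 < weight R N g by rewrite lt_def w0 weight_ge0.
rewrite gt_eqF // (@le_lt_trans _ _ 0) ?mulr_gt0 //.
by rewrite mulr_le0_ge0 ?weight_ge0 // subr_le0 ler_nat.
Qed.

(** * Lipschitz functions on the unit box *)

Definition in_box (R : realType) (n : nat) (u : 'I_n -> R) : Prop :=
  forall i, 0 <= u i <= 1.

(** The single constant B bounds the function and is a Lipschitz constant for
    the sup distance. *)
Definition box_lipschitz (R : realType) (n : nat) (h : ('I_n -> R) -> R) : Prop :=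
  exists B : R, [/\ 0 <= B,
    forall u, in_box u -> `|h u| <= B &
    forall u v d, in_box u -> in_box v -> 0 <= d ->
      (forall i, `|u i - v i| <= d) -> `|h u - h v| <= B * d].

Lemma box_lipschitz_cst (R : realType) (n : nat) (c : R) :
  box_lipschitz (fun _ : 'I_n -> R => c).
Proof.
exists `|c|; split=> // u v d _ _ d0 _.
by rewrite subrr normr0 mulr_ge0.
Qed.

Lemma box_lipschitz_proj (R : realType) (n : nat) (i : 'I_n) :
  box_lipschitz (fun u : 'I_n -> R => u i).
Proof.
exists 1; split=> // [u /(_ i)/andP[u0 u1]|u v d _ _ _ /(_ i)]; last by rewrite mul1r.
by rewrite ger0_norm.
Qed.

Lemma box_lipschitzD (R : realType) (n : nat) (h k : ('I_n -> R) -> R) :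
  box_lipschitz h -> box_lipschitz k -> box_lipschitz (fun u => h u + k u).
Proof.
move=> [B [B0 hB hL]] [C [C0 kC kL]]; exists (B + C); split.
- exact: addr_ge0.
- move=> u ub; apply: le_trans (ler_normD _ _) _.
  by apply: lerD; [exact: hB|exact: kC].
- move=> u v d ub vb d0 huv.
  rewrite (_ : _ - _ = (h u - h v) + (k u - k v)); last by ring.
  apply: le_trans (ler_normD _ _) _; rewrite mulrDl.
  by apply: lerD; [exact: hL|exact: kL].
Qed.

Lemma box_lipschitzM (R : realType) (n : nat) (h k : ('I_n -> R) -> R) :
  box_lipschitz h -> box_lipschitz k -> box_lipschitz (fun u => h u * k u).
Proof.
move=> [B [B0 hB hL]] [C [C0 kC kL]]; exists (B * C + B * C); split.
- by rewrite addr_ge0 ?mulr_ge0.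
- move=> u ub; rewrite normrM; apply: (@le_trans _ _ (B * C)).
    by apply: ler_pM; rewrite ?normr_ge0 ?hB ?kC.
  by rewrite lerDl mulr_ge0.
- move=> u v d ub vb d0 huv.
  rewrite (_ : _ - _ = h u * (k u - k v) + (h u - h v) * k v); last by ring.
  apply: le_trans (ler_normD _ _) _; rewrite !normrM mulrDl.
  apply: lerD.
    by rewrite -mulrA; apply: ler_pM; rewrite ?normr_ge0 ?hB ?kL.
  by rewrite mulrAC; apply: ler_pM; rewrite ?normr_ge0 ?hL ?kC.
Qed.

Lemma box_lipschitz_max0N (R : realType) (n : nat) (h : ('I_n -> R) -> R) :
  box_lipschitz h -> box_lipschitz (fun u => Num.max 0 (- h u)).
Proof.
move=> [B [B0 hB hL]]; exists B; split=> // [u /hB hu|u v d ub vb d0 huv].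
  rewrite ger0_norm ?le_max ?lexx // ge_max B0 /=.
  by rewrite (le_trans (ler_norm _)) // normrN.
apply: le_trans (hL u v d ub vb d0 huv).
case: (leP 0 (- h u)) => hu; case: (leP 0 (- h v)) => hv.
- by rewrite -normrN !opprB opprK addrC.
- rewrite subr0 ger0_norm // -normrN; apply: le_trans (ler_norm _); lra.
- rewrite sub0r normrN ger0_norm //; apply: le_trans (ler_norm _); lra.
- by rewrite subrr normr0 normr_ge0.
Qed.

Lemma box_lipschitz_meval (R : realType) (n : nat) (p : {mpoly R[n]}) :
  box_lipschitz (fun u => p.@[u]).
Proof.
elim/mpolyind: p => [|c m p _ _ IH].
  rewrite (_ : (fun u => _) = (fun=> 0)); last by apply/funext => u; rewrite meval0.
  exact: box_lipschitz_cst.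
rewrite (_ : (fun u => _) = (fun u => c * (\prod_(i < n) u i ^+ m i) + p.@[u])); last first.
  by apply/funext => u; rewrite mevalD mevalZ mevalX.
apply: box_lipschitzD => //; apply: box_lipschitzM; first exact: box_lipschitz_cst.
elim: (index_enum _) => [|i r IHr].
  rewrite (_ : (fun u => _) = (fun=> 1)); last by apply/funext => u; rewrite big_nil.
  exact: box_lipschitz_cst.
rewrite (_ : (fun u => _) = (fun u => u i ^+ m i * \prod_(j <- r) u j ^+ m j)); last first.
  by apply/funext => u; rewrite big_cons.
apply: box_lipschitzM => //; elim: (m i) => [|k IHk]; first exact: box_lipschitz_cst.
under eq_fun do rewrite exprS.
by apply: box_lipschitzM => //; exact: box_lipschitz_proj.
Qed.

(** * Approximation of Bernstein coefficients *)

Definition grid_point (R : realType) (n N : nat) (g : 'X_{1..n}) : 'I_n -> R :=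
  fun i => (g i)%:R / N%:R.

(** The Bernstein coefficients of p N in degree N, that is its coefficients
    divided by the multinomial ones, are the values of h at the points g / N up
    to O(1/N). Multiplying out by the weight avoids the division and, for
    N >= N0, forces deg (p N) <= N, because the weights vanish beyond degree N. *)
Definition bernstein_approx (R : realType) (n : nat) (p : nat -> {mpoly R[n]})
    (h : ('I_n -> R) -> R) : Prop :=
  exists (C : R) (N0 : nat), 0 <= C /\ forall N, (N0 <= N)%N -> forall g,
    `|(p N)@_g - weight R N g * h (grid_point R N g)| <= weight R N g * (C / N%:R).

Lemma mnm_le_mdeg (n : nat) (g : 'X_{1..n}) i : (g i <= mdeg g)%N.
Proof. by rewrite mdegE (bigD1 i) //= leq_addr. Qed.

Lemma grid_point_box (R : realType) (n N : nat) (g : 'X_{1..n}) :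
  (mdeg g <= N)%N -> in_box (grid_point R N g).
Proof.
move=> gN i; rewrite /grid_point divr_ge0 //=.
have [->|N0] := posnP N; first by rewrite invr0 mulr0.
by rewrite ler_pdivrMr ?ltr0n // mul1r ler_nat (leq_trans (mnm_le_mdeg g i)).
Qed.

Lemma grid_point_shift (R : realType) (n N : nat) (g h : 'X_{1..n}) :
  (0 < N)%N -> (mdeg h <= N)%N ->
  (forall i, (h i <= g i <= (h i).+1)%N) ->
  forall i, `|grid_point R N h i - grid_point R N.+1 g i| <= 1 / N%:R.
Proof.
move=> N0 hN hg i; rewrite /grid_point.
have Np : 0 < N%:R :> R by rewrite ltr0n.
have NSp : 0 < N.+1%:R :> R by rewrite ltr0n.
have a0 : 0 <= (h i)%:R :> R by [].
have aN : (h i)%:R <= N%:R :> R by rewrite ler_nat (leq_trans (mnm_le_mdeg h i)).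
set a : R := (h i)%:R in a0 aN *.
have -> : a / N%:R - (g i)%:R / N.+1%:R =
    (a - ((g i)%:R - a) * N%:R) / (N%:R * N.+1%:R).
  by rewrite -natr1; field; rewrite natr1 !gt_eqF.
have /andP[d0 d1] : 0 <= (g i)%:R - a <= 1.
  have /andP[h1 h2] := hg i.
  by rewrite subr_ge0 ler_nat h1 /= lerBlDr /a nat1r ler_nat.
rewrite normrM normfV (ger0_norm (mulr_ge0 (ltW Np) (ltW NSp))).
rewrite ler_pdivrMr ?mulr_gt0 // mul1r mulrA mulVf ?gt_eqF // mul1r.
rewrite -natr1 ler_norml; nra.
Qed.

(** Raising the degree from N to N.+1 multiplies a Bernstein coefficient by
    theta, a ratio of multinomial coefficients, and moves the sampling point by
    at most 1/N in every coordinate; the Lipschitz constant absorbs this move. *)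
Lemma bernstein_approx_step (R : realType) (n : nat) (h : ('I_n -> R) -> R) (B C : R) :
  0 <= B -> 0 <= C ->
  (forall u v d, in_box u -> in_box v -> 0 <= d ->
      (forall i, `|u i - v i| <= d) -> `|h u - h v| <= B * d) ->
  forall N (g g' : 'X_{1..n}) (c theta : R), (0 < N)%N ->
    (forall i, (g' i <= g i <= (g' i).+1)%N) ->
    (mdeg g <= N.+1)%N -> (mdeg g' <= N)%N -> 0 <= theta <= 1 ->
    weight R N g' = weight R N.+1 g * theta ->
    `|c - weight R N g' * h (grid_point R N g')| <= weight R N g' * (C / N%:R) ->
    `|c - weight R N.+1 g * (theta * h (grid_point R N.+1 g))|
       <= weight R N.+1 g * ((2 * (B + C)) / N.+1%:R).
Proof.
move=> B0 C0 hL N g g' c theta N0 gg' gN g'N /andP[t0 t1] wE hc.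
have Np : 0 < N%:R :> R by rewrite ltr0n.
have hN : `|h (grid_point R N g') - h (grid_point R N.+1 g)| <= B * (1 / N%:R).
  apply: hL; [exact: grid_point_box|exact: grid_point_box| |].
    by rewrite divr_ge0.
  exact: grid_point_shift.
rewrite mulrA -wE.
have w0 := weight_ge0 R N g'; have w0' := weight_ge0 R N.+1 g.
have -> : c - weight R N g' * h (grid_point R N.+1 g) =
   (c - weight R N g' * h (grid_point R N g')) +
   weight R N g' * (h (grid_point R N g') - h (grid_point R N.+1 g)) by ring.
apply: le_trans (ler_normD _ _) _; rewrite normrM (ger0_norm w0).
apply: (@le_trans _ _ (weight R N g' * ((B + C) / N%:R))).
  apply: le_trans (lerD hc (ler_wpM2l w0 hN)) _.
  by rewrite -mulrDr mul1r -mulrDl [C + B]addrC.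
rewrite wE -mulrA; apply: ler_wpM2l => //.
apply: (@le_trans _ _ ((B + C) / N%:R)).
  by apply: ler_piMl => //; rewrite divr_ge0 ?addr_ge0.
rewrite ler_pdivrMr // mulrAC ler_pdivlMr ?ltr0n //.
have N1 : 1 <= N%:R :> R by rewrite ler1n.
by rewrite -natr1; have : 0 <= B + C := addr_ge0 B0 C0; nra.
Qed.

(** Here theta is the i-th coordinate g_i / N.+1 of the sampling point. *)
Lemma bernstein_approx_XM (R : realType) (n : nat) (i : 'I_n) p (h : ('I_n -> R) -> R) :
  box_lipschitz h -> bernstein_approx p h ->
  bernstein_approx (fun N => 'X_i * p N.-1) (fun u => u i * h u).
Proof.
move=> [B [B0 hB hL]] [C [N0 [C0 H]]].
exists (2 * (B + C)), (maxn 1 N0).+1; split; first by rewrite mulr_ge0 ?addr_ge0.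
case=> // N; rewrite ltnS geq_max => /andP[N1 N0N] g /=.
have [gi|/mnm_predU[g' E]] := eqVneq (g i) 0%N.
  rewrite mcoeff_XM0 // /grid_point gi !mul0r mulr0 subrr normr0.
  by rewrite mulr_ge0 ?weight_ge0 ?divr_ge0 ?mulr_ge0 ?addr_ge0.
have cE : ('X_i * p N)@_g = (p N)@_g' by rewrite E mcoeff_XM.
rewrite cE; have Hg' := H _ N0N g'.
have dE : mdeg g = (mdeg g').+1 by rewrite E mdegD mdeg1 addn1.
have [gN|Ng] := leqP (mdeg g) N.+1; last first.
  rewrite !(weight_eq0 _ Ng) !mul0r subr0.
  by move: Hg'; rewrite !weight_eq0 ?mul0r ?subr0 // -ltnS -dE.
apply: (bernstein_approx_step B0 C0 hL N1 _ gN _ _ _ Hg').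
- move=> j; rewrite E mnmDE mnm1E; case: (i == j); lia.
- by rewrite -ltnS -dE.
- exact: grid_point_box.
- have := weightXU R N i g'; rewrite -E /grid_point => E'.
  have -> : g i = (g' i).+1 by rewrite E mnmDE mnm1E eqxx addn1.
  by rewrite mulrA [weight _ _ g * _]mulrC -E' mulrC mulKf ?pnatr_eq0.
Qed.

(** The homogenizing barycentric coordinate. *)
Definition slack (R : realType) (n : nat) : {mpoly R[n]} := 1 - \sum_(i < n) 'X_i.

Lemma meval_slack (R : realType) (n : nat) (u : 'I_n -> R) :
  (slack R n).@[u] = 1 - \sum_i u i.
Proof.
rewrite mevalB meval1 (raddf_sum (meval u)).
by under eq_bigr => i _ do rewrite /= mevalXU.
Qed.

Lemma slack_grid (R : realType) (n N : nat) (g : 'X_{1..n}) : (0 < N)%N ->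
  (slack R n).@[grid_point R N g] = (N%:R - (mdeg g)%:R) / N%:R.
Proof.
move=> N0; rewrite meval_slack /grid_point -mulr_suml -natr_sum -mdegE mulrBl.
by rewrite divff // pnatr_eq0 -lt0n.
Qed.

(** Here theta is 1 - |g| / N.+1: leaving the polynomial as it is while the
    degree increases amounts to a product with the homogenizing variable. *)
Lemma bernstein_approx_1M (R : realType) (n : nat) p (h : ('I_n -> R) -> R) :
  box_lipschitz h -> bernstein_approx p h ->
  bernstein_approx (fun N => p N.-1) (fun u => (slack R n).@[u] * h u).
Proof.
move=> [B [B0 hB hL]] [C [N0 [C0 H]]].
exists (2 * (B + C)), (maxn 1 N0).+1; split; first by rewrite mulr_ge0 ?addr_ge0.
case=> // N; rewrite ltnS geq_max => /andP[N1 N0N] g /=.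
have Hg := H _ N0N g.
have E' := weight1 R N g.
have wE : weight R N g = weight R N.+1 g * (slack R n).@[grid_point R N.+1 g].
  by rewrite slack_grid // mulrA [weight _ _ g * _]mulrC -E' mulrC mulKf ?pnatr_eq0.
have [gN|Ng] := leqP (mdeg g) N; last first.
  rewrite [X in `|_ - X|]mulrA -wE; move: Hg; rewrite (weight_eq0 _ Ng) !mul0r.
  move=> /le_trans; apply.
  by rewrite mulr_ge0 ?weight_ge0 ?divr_ge0 ?mulr_ge0 ?addr_ge0.
apply: (bernstein_approx_step B0 C0 hL N1 _ _ _ _ wE Hg) => //.
- by move=> j; lia.
- exact: leqW.
- rewrite slack_grid // divr_ge0 ?subr_ge0 ?ler_nat ?(leqW gN) //=.
  by rewrite ler_pdivrMr ?ltr0n // mul1r lerBlDr lerDl.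
Qed.

Lemma bernstein_approxD (R : realType) (n : nat) p q (h k : ('I_n -> R) -> R) :
  bernstein_approx p h -> bernstein_approx q k ->
  bernstein_approx (fun N => p N + q N) (fun u => h u + k u).
Proof.
move=> [C [N0 [C0 H]]] [D [N1 [D0 K]]]; exists (C + D), (maxn N0 N1).
split=> [|N]; first exact: addr_ge0.
rewrite geq_max => /andP[N0N N1N] g; rewrite mcoeffD.
rewrite [X in `|X|](_ : _ = ((p N)@_g - weight R N g * h (grid_point R N g)) +
  ((q N)@_g - weight R N g * k (grid_point R N g))); last by ring.
apply: le_trans (ler_normD _ _) _; rewrite [_ / _]mulrDl mulrDr.
by apply: lerD; [exact: H|exact: K].
Qed.

Lemma bernstein_approxZ (R : realType) (n : nat) p c (h : ('I_n -> R) -> R) :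
  bernstein_approx p h -> bernstein_approx (fun N => c *: p N) (fun u => c * h u).
Proof.
move=> [C [N0 [C0 H]]]; exists (`|c| * C), N0; split=> [|N N0N g].
  by rewrite mulr_ge0.
rewrite mcoeffZ mulrCA -mulrBr normrM -mulrA mulrCA ler_wpM2l //.
exact: H.
Qed.

Lemma bernstein_approx_sum (R : realType) (n : nat) (I : Type) (r : seq I)
    (p : I -> nat -> {mpoly R[n]}) (h : I -> ('I_n -> R) -> R) :
  (forall i, bernstein_approx (p i) (h i)) ->
  bernstein_approx (fun N => \sum_(i <- r) p i N) (fun u => \sum_(i <- r) h i u).
Proof.
move=> H; elim: r => [|i r IH].
  exists 0, 0%N; split=> // N _ g; rewrite !big_nil mcoeff0 mulr0 subrr normr0.
  by rewrite mul0r mulr0.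
under eq_fun do rewrite big_cons.
under [X in bernstein_approx _ X]eq_fun do rewrite big_cons.
exact: bernstein_approxD.
Qed.

(** The degree D homogenization of q, with the homogenizing variable replaced by
    1 - (u_1 + ... + u_n): the homogeneous polynomial restricted to the
    standard simplex, in the coordinates u. *)
Definition homogenize (R : realType) (n D : nat) (q : {mpoly R[n]}) : {mpoly R[n]} :=
  \sum_(b : 'X_{1..n < D.+1}) q@_b *: ('X_[b] * slack R n ^+ (D - mdeg b)).

(** Every factor of the homogenized monomial, a variable or the homogenizing
    one, raises the degree by one. *)
Lemma bernstein_approx_mX (R : realType) (n D : nat) p (h : ('I_n -> R) -> R)
    (b : 'X_{1..n}) : (mdeg b <= D)%N ->
  box_lipschitz h -> bernstein_approx p h ->
  bernstein_approx (fun N => 'X_[b] * p (N - D)%N)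
    (fun u => ('X_[b] * slack R n ^+ (D - mdeg b)).@[u] * h u).
Proof.
move=> bD th ph; elim: D b bD => [|D IH] b bD.
  move: bD; rewrite leqn0 mdeg_eq0 => /eqP ->.
  under eq_fun do rewrite mpolyX0 mul1r subn0.
  under [X in bernstein_approx _ X]eq_fun do rewrite mpolyX0 mul1r sub0n expr0 meval1 mul1r.
  exact: ph.
have th' b' d : box_lipschitz (fun u : 'I_n -> R => ('X_[b'] * slack R n ^+ d).@[u] * h u).
  by apply: box_lipschitzM => //; exact: box_lipschitz_meval.
have E N : (N - D.+1 = N.-1 - D)%N by lia.
have [bD'|] := leqP (mdeg b) D.
  have := bernstein_approx_1M (th' _ _) (IH b bD').
  congr bernstein_approx; apply/funext => u; first by rewrite E.
  by rewrite subSn // exprS !mevalM; ring.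
move=> Db; have {Db}bE : mdeg b = D.+1 by apply/eqP; rewrite eqn_leq bD Db.
have [i bi] : exists i, b i != 0%N.
  apply/existsP; rewrite -[[exists _, _]]negbK negb_exists; apply/negP => /forallP h0.
  by move: bE; rewrite mdegE big1 // => i _; apply/eqP; rewrite -[_ == _]negbK.
have [b' bE'] := mnm_predU bi.
have b'D : mdeg b' = D by move: bE; rewrite bE' mdegD mdeg1 addn1 => -[].
have b'D' : (mdeg b' <= D)%N by rewrite b'D.
have := bernstein_approx_XM i (th' _ _) (IH b' b'D').
congr bernstein_approx; apply/funext => u.
  by rewrite E bE' mulrA mpolyXD [_ * 'X_i]mulrC.
rewrite bE b'D !subnn !expr0 !mulr1 bE' mpolyXD mevalM mevalXU; ring.
Qed.

(** This is the quantitative form of Pólya's argument: multiplication by q acts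
    on Bernstein coefficients like multiplication of functions by the
    homogenization of q. *)
Lemma bernstein_approx_polyM (R : realType) (n D : nat) p (h : ('I_n -> R) -> R)
    (q : {mpoly R[n]}) : (msize q <= D.+1)%N ->
  box_lipschitz h -> bernstein_approx p h ->
  bernstein_approx (fun N => q * p (N - D)%N) (fun u => (homogenize D q).@[u] * h u).
Proof.
move=> qD th ph.
have := @bernstein_approx_sum R n _ (index_enum 'X_{1..n < D.+1})
  (fun b N => q@_b *: ('X_[b] * p (N - D)%N)) _
  (fun b => bernstein_approxZ q@_b (bernstein_approx_mX (bmdeg b) th ph)).
congr bernstein_approx; apply/funext => u.
  rewrite [in RHS](mpolywE qD) mulr_suml; apply: eq_bigr => b _.
  by rewrite scalerAl.
rewrite raddf_sum mulr_suml; apply: eq_bigr => b _.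
by rewrite /= mevalZ mulrA.
Qed.

Definition bernstein (R : realType) (n N : nat) (h : ('I_n -> R) -> R) :
    {mpoly R[n]} :=
  \sum_(g : 'X_{1..n < N.+1}) (weight R N g * h (grid_point R N g)) *: 'X_[g].

Lemma mcoeff_bernstein (R : realType) (n N : nat) (h : ('I_n -> R) -> R) g :
  (bernstein N h)@_g = weight R N g * h (grid_point R N g).
Proof.
have [gN|Ng] := leqP (mdeg g) N.
  rewrite /bernstein.
  by rewrite (mcoeff_mpoly (fun g => weight R N g * h (grid_point R N g))).
rewrite weight_eq0 // mul0r /bernstein raddf_sum /= big1 // => b _.
rewrite mcoeffZ mcoeffX; case: eqP => [E|]; last by rewrite mulr0.
by have := bmdeg b; rewrite ltnS E leqNgt Ng.
Qed.

Lemma bernstein_approx_bernstein (R : realType) (n : nat) (h : ('I_n -> R) -> R) :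
  bernstein_approx (fun N => bernstein N h) h.
Proof.
exists 0, 0%N; split=> // N _ g.
by rewrite mcoeff_bernstein subrr normr0 mul0r mulr0.
Qed.

Lemma bernstein_approx_simplex (R : realType) (n : nat) :
  bernstein_approx (fun N => simplex_form R n ^+ N) (fun=> 1).
Proof.
exists 0, 0%N; split=> // N _ g.
by rewrite mulr1 subrr normr0 mul0r mulr0.
Qed.

(** * Degrees and homogenization *)

Lemma msize_coefP (R : realType) (n N : nat) (p : {mpoly R[n]}) :
  (forall g, (N <= mdeg g)%N -> p@_g = 0) -> (msize p <= N)%N.
Proof.
move=> h; rewrite msizeE; apply/bigmax_leqP_seq => g gp _.
by rewrite ltnNge; apply/negP => /h/eqP; rewrite mcoeff_eq0 gp.
Qed.

Lemma coef_msize0 (R : realType) (n N : nat) (p : {mpoly R[n]}) g :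
  (msize p <= N)%N -> (N <= mdeg g)%N -> p@_g = 0.
Proof.
by move=> pN Ng; apply: memN_msupp_eq0; apply: msize_mdeg_ge; exact: leq_trans pN Ng.
Qed.

Lemma msizeD_leq (R : realType) (n N : nat) (p q : {mpoly R[n]}) :
  (msize p <= N)%N -> (msize q <= N)%N -> (msize (p + q) <= N)%N.
Proof.
by move=> pN qN; rewrite (leq_trans (msizeD_le _ _)) // geq_max pN.
Qed.

Lemma msize_sum_leq (R : realType) (n N : nat) (I : Type) (r : seq I)
    (F : I -> {mpoly R[n]}) :
  (forall i, (msize (F i) <= N)%N) -> (msize (\sum_(i <- r) F i) <= N)%N.
Proof.
move=> h; elim/big_rec: _ => [|i p _ pN]; first by rewrite mmeasure0.
exact: msizeD_leq.
Qed.

Lemma msizeM_leq (R : realType) (n a b : nat) (p q : {mpoly R[n]}) :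
  (msize p <= a.+1)%N -> (msize q <= b.+1)%N -> (msize (p * q) <= (a + b).+1)%N.
Proof.
move=> pa qb; have [->|p0] := eqVneq p 0; first by rewrite mul0r mmeasure0.
have [->|q0] := eqVneq q 0; first by rewrite mulr0 mmeasure0.
rewrite msizeM //; apply: (@leq_trans (a.+1 + b.+1).-1); last by rewrite addSn addnS.
by rewrite -!subn1 leq_sub2r // leq_add.
Qed.

Lemma msize_simplex_form (R : realType) (n : nat) :
  (msize (simplex_form R n) <= 2)%N.
Proof.
apply: msizeD_leq; first by rewrite mmeasure1.
by apply: msize_sum_leq => i; rewrite msizeX mdeg1.
Qed.

Lemma msize_simplex_exp (R : realType) (n k : nat) :
  (msize (simplex_form R n ^+ k) <= k.+1)%N.
Proof.
elim: k => [|k IH]; first by rewrite expr0 mmeasure1.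
by rewrite exprS; apply: (@msizeM_leq _ _ 1 k) => //; exact: msize_simplex_form.
Qed.

Lemma homogenizeX (R : realType) (n D : nat) (b : 'X_{1..n}) : (mdeg b <= D)%N ->
  homogenize D ('X_[b] : {mpoly R[n]}) = 'X_[b] * slack R n ^+ (D - mdeg b).
Proof.
move=> bD; rewrite /homogenize.
have bD' : (mdeg b < D.+1)%N by [].
rewrite (bigD1 (BMultinom bD')) //= mcoeffX eqxx scale1r big1 ?addr0 // => b' ne.
rewrite mcoeffX; case: eqP => [E|]; last by rewrite scale0r.
by case/eqP: ne; apply/val_inj.
Qed.

Lemma homogenizeD (R : realType) (n D : nat) (p q : {mpoly R[n]}) :
  homogenize D (p + q) = homogenize D p + homogenize D q.
Proof.
by rewrite /homogenize -big_split; apply: eq_bigr => b _; rewrite mcoeffD scalerDl.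
Qed.

Lemma homogenizeZ (R : realType) (n D : nat) c (p : {mpoly R[n]}) :
  homogenize D (c *: p) = c *: homogenize D p.
Proof.
by rewrite /homogenize scaler_sumr; apply: eq_bigr => b _; rewrite mcoeffZ scalerA.
Qed.

Lemma homogenize1 (R : realType) (n D : nat) :
  homogenize D (1 : {mpoly R[n]}) = slack R n ^+ D.
Proof. by rewrite -mpolyX0 homogenizeX mdeg0 // subn0 mpolyX0 mul1r. Qed.

(** On the face at infinity, where the slack vanishes, the ball constraint is
    equal to -1: this is what makes the problem compact. *)
Lemma homogenize_ball (R : realType) (n : nat) (L : R) (u : 'I_n -> R) :
  (homogenize 1 (L%:MP - \sum_(i < n) 'X_i)).@[u] = (L + 1) * (slack R n).@[u] - 1.
Proof.
have -> : L%:MP - \sum_(i < n) 'X_i = L *: 1 + (-1) *: \sum_(i < n) 'X_i :> {mpoly R[n]}.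
  by rewrite alg_mpolyC scaleN1r.
rewrite homogenizeD !homogenizeZ homogenize1 expr1.
have -> : homogenize 1 (\sum_(i < n) 'X_i) = \sum_(i < n) 'X_i :> {mpoly R[n]}.
  rewrite (@big_morph _ _ (homogenize 1) 0 +%R 0 +%R); last 2 first.
  - exact: homogenizeD.
  - by have := homogenizeZ 1 0 (0 : {mpoly R[n]}); rewrite !scale0r.
  by apply: eq_bigr => i _; rewrite homogenizeX mdeg1 // subnn mulr1.
have -> : \sum_(i < n) 'X_i = 1 - slack R n by rewrite /slack subKr.
rewrite mevalD !mevalZ [(1 - slack R n).@[u]]mevalB meval1; ring.
Qed.

Lemma meval_homogenize (R : realType) (n D : nat) (q : {mpoly R[n]})
    (u : 'I_n -> R) (u0 := (slack R n).@[u]) :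
  (msize q <= D.+1)%N -> 0 < u0 ->
  (homogenize D q).@[u] = u0 ^+ D * q.@[fun i => u i / u0].
Proof.
move=> qD u0_gt0.
rewrite [in RHS](mpolywE qD) /homogenize !raddf_sum /= mulr_sumr.
apply: eq_bigr => b _; rewrite !mevalZ mevalM rmorphXn /= -/u0 !mevalX.
under [in RHS]eq_bigr => i _ do rewrite exprMn exprVn.
rewrite big_split /= prodfV prodrXr -mdegE.
have bD : (mdeg b <= D)%N by rewrite -ltnS bmdeg.
have -> : u0 ^+ D = u0 ^+ (D - mdeg b) * u0 ^+ mdeg b by rewrite -exprD subnK.
field.
by rewrite expf_neq0 // gt_eqF.
Qed.

(** * The cone of certificates *)

(** The certificates of degree N after the substitution of x_i^2 by y_i: sums of
    monomial squares become polynomials with nonnegative coefficients, and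
    degrees are halved. *)
Definition cone (R : realType) (n m : nat) (G : 'I_m.+1 -> {mpoly R[n]})
    (N : nat) (p : {mpoly R[n]}) : Prop :=
  exists s : 'I_m.+1 -> {mpoly R[n]},
    [/\ forall j, coef_ge0 (s j), forall j, (msize (s j * G j) <= N.+1)%N &
        p = \sum_j s j * G j].

Lemma coneD (R : realType) (n m N : nat) (G : 'I_m.+1 -> {mpoly R[n]}) p q :
  cone G N p -> cone G N q -> cone G N (p + q).
Proof.
move=> [s [s0 sN ->]] [t [t0 tN ->]]; exists (fun j => s j + t j); split.
- by move=> j; exact: coef_ge0D.
- by move=> j; rewrite mulrDl msizeD_leq.
- by rewrite -big_split; apply: eq_bigr => j _; rewrite mulrDl.
Qed.

Lemma coneZ (R : realType) (n m N : nat) (G : 'I_m.+1 -> {mpoly R[n]}) c p :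
  0 <= c -> cone G N p -> cone G N (c *: p).
Proof.
move=> c0 [s [s0 sN ->]]; exists (fun j => c *: s j); split.
- by move=> j; exact: coef_ge0Z.
- by move=> j; rewrite -scalerAl (leq_trans (msizeZ_le _ _)).
- by rewrite scaler_sumr; apply: eq_bigr => j _; rewrite scalerAl.
Qed.

Lemma cone_term (R : realType) (n m N : nat) (G : 'I_m.+1 -> {mpoly R[n]}) j p :
  coef_ge0 p -> (msize (p * G j) <= N.+1)%N -> cone G N (p * G j).
Proof.
move=> p0 pN; exists (fun i => if i == j then p else 0); split.
- by move=> i; case: eqP => // _; exact: coef_ge0_0.
- by move=> i; case: eqP => [->//|_]; rewrite mul0r mmeasure0.
- by rewrite (bigD1 j) //= eqxx big1 ?addr0 // => i /negPf ->; rewrite mul0r.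
Qed.

Lemma cone0 (R : realType) (n m N : nat) (G : 'I_m.+1 -> {mpoly R[n]}) :
  cone G N 0.
Proof.
rewrite -(mul0r (G ord0)); apply: cone_term; first exact: coef_ge0_0.
by rewrite mul0r mmeasure0.
Qed.

Lemma cone_sum (R : realType) (n m N : nat) (G : 'I_m.+1 -> {mpoly R[n]})
    (I : Type) (r : seq I) (F : I -> {mpoly R[n]}) :
  (forall i, cone G N (F i)) -> cone G N (\sum_(i <- r) F i).
Proof.
by move=> h; elim/big_ind: _ => //; [exact: cone0|move=> p q; exact: coneD].
Qed.

Lemma cone_simplexM (R : realType) (n m N k : nat)
    (G : 'I_m.+1 -> {mpoly R[n]}) p :
  cone G N p -> cone G (k + N) (simplex_form R n ^+ k * p).
Proof.
move=> [s [s0 sN ->]]; exists (fun j => simplex_form R n ^+ k * s j); split.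
- move=> j; apply: coef_ge0M => //; apply: coef_ge0_exp; exact: coef_ge0_simplex.
- by move=> j; rewrite -mulrA; apply: msizeM_leq => //; exact: msize_simplex_exp.
- by rewrite mulr_sumr; apply: eq_bigr => j _; rewrite mulrA.
Qed.

Lemma cone_coef_ge0 (R : realType) (n m N : nat) (G : 'I_m.+1 -> {mpoly R[n]}) p :
  G ord_max = 1 -> coef_ge0 p -> (msize p <= N.+1)%N -> cone G N p.
Proof.
by move=> G1 p0 pN; rewrite -[p]mulr1 -G1; apply: cone_term => //; rewrite G1 mulr1.
Qed.

Lemma cone_leq (R : realType) (n m N N' : nat) (G : 'I_m.+1 -> {mpoly R[n]}) p :
  (N <= N')%N -> cone G N p -> cone G N' p.
Proof.
move=> NN' [s [s0 sN ->]]; exists s; split=> // j.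
exact: leq_trans (sN j) _.
Qed.

(** Induction on the degree: for b = b' + e_i,
    L^(d+1) - y^b = L (L^d - y^b') + y^b' (L - y_i), and L - y_i is the first
    generator plus the sum of the other variables. *)
Lemma cone_bound_monomial (R : realType) (n m : nat)
    (G : 'I_m.+1 -> {mpoly R[n]}) (L : R) (b : 'X_{1..n}) :
  0 < L -> G ord0 = L%:MP - \sum_(i < n) 'X_i -> G ord_max = 1 ->
  cone G (mdeg b) ((L ^+ mdeg b)%:MP - 'X_[b]).
Proof.
move=> L0 G0 G1; move: {2}(mdeg b) (erefl (mdeg b)) => d.
elim: d b => [|d IH] b bd.
  move/eqP: bd; rewrite mdeg_eq0 => /eqP ->.
  by rewrite mdeg0 expr0 mpolyX0 mpolyC1 subrr; exact: cone0.
have [i bi] : exists i, b i != 0%N.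
  apply/existsP; rewrite -[[exists _, _]]negbK negb_exists; apply/negP => /forallP h0.
  by move: bd; rewrite mdegE big1 // => i _; apply/eqP; rewrite -[_ == _]negbK.
have [b' bE] := mnm_predU bi.
have b'd : mdeg b' = d by move: bd; rewrite bE mdegD mdeg1 addn1 => -[].
have := IH _ b'd; rewrite b'd bd => IH'.
have -> : (L ^+ d.+1)%:MP - 'X_[b] = L *: ((L ^+ d)%:MP - 'X_[b']) +
    ('X_[b'] * G ord0 + \sum_(j < n | j != i) 'X_[b'] * 'X_j) :> {mpoly R[n]}.
  rewrite G0 (bigD1 i) //= -mulr_sumr bE mpolyXD exprS mpolyCM -mul_mpolyC.
  ring.
apply: coneD; first by apply: coneZ (ltW L0) (cone_leq (leqnSn _) IH').
have szX : (msize ('X_[R, b'] : {mpoly R[n]}) <= d.+1)%N by rewrite msizeX b'd.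
apply: coneD.
  apply: cone_term; first exact: coef_ge0X.
  rewrite -addn1; apply: msizeM_leq => //; rewrite G0; apply: msizeD_leq.
    by rewrite msizeC; case: eqP.
  rewrite mmeasureN; apply: msize_sum_leq => j; by rewrite msizeX mdeg1.
apply: cone_coef_ge0 => //.
  by apply: coef_ge0_sum => j _; apply: coef_ge0M; exact: coef_ge0X.
rewrite big_mkcond; apply: msize_sum_leq => j; case: ifP => _; last by rewrite mmeasure0.
by rewrite -addn1; apply: msizeM_leq => //; rewrite msizeX mdeg1.
Qed.

(** Sum the bounds |y^b| <= L^|b| over the monomials of p. *)
Lemma cone_archimedean (R : realType) (n m N : nat)
    (G : 'I_m.+1 -> {mpoly R[n]}) (L : R) (p : {mpoly R[n]}) :
  0 < L -> G ord0 = L%:MP - \sum_(i < n) 'X_i -> G ord_max = 1 ->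
  (msize p <= N.+1)%N ->
  exists C : R, forall eps, C <= eps -> cone G N (p + eps%:MP).
Proof.
move=> L0 G0 G1 pN.
exists (\sum_(b : 'X_{1..n < N.+1}) `|p@_b| * L ^+ mdeg b) => eps Ceps.
have coneC c : 0 <= c -> cone G N c%:MP.
  move=> c0; apply: cone_coef_ge0 => //.
    by rewrite -alg_mpolyC; apply: coef_ge0Z => //; exact: coef_ge0_1.
  by rewrite msizeC; case: eqP.
have -> : p + eps%:MP = \sum_(b : 'X_{1..n < N.+1})
   (p@_b *: 'X_[b] + (`|p@_b| * L ^+ mdeg b)%:MP) +
   (eps - \sum_(b : 'X_{1..n < N.+1}) `|p@_b| * L ^+ mdeg b)%:MP.
  rewrite big_split /= -(mpolywE pN) mpolyCB (raddf_sum (@mpolyC n R)) /=.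
  by rewrite -addrA; congr (_ + _); rewrite addrC subrK.
apply: coneD; last by apply: coneC; rewrite subr_ge0.
apply: cone_sum => b; have bN : (mdeg b <= N)%N by rewrite -ltnS bmdeg.
have [pb|pb] := leP 0 p@_b.
  apply: coneD; last by apply: coneC; rewrite mulr_ge0 ?exprn_ge0 ?(ltW L0).
  by apply: cone_coef_ge0 => //; [apply: coef_ge0Z => //; exact: coef_ge0X|
     rewrite (leq_trans (msizeZ_le _ _)) // msizeX].
rewrite (_ : _ + _ = `|p@_b| *: ((L ^+ mdeg b)%:MP - 'X_[b])).
  apply: coneZ => //; apply: cone_leq bN _; exact: cone_bound_monomial G0 G1.
rewrite ltr0_norm // -!mul_mpolyC mpolyCM mpolyCN; ring.
Qed.

(** * Penalization on the simplex *)

Definition simplex_ineqs (R : realType) (n : nat) : seq {mpoly R[n]} :=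
  slack R n :: [seq 'X_i | i <- enum 'I_n].

Lemma simplex_ineqsP (R : realType) (n : nat) (u : 'I_n -> R) :
  (forall r, r \in simplex_ineqs R n -> 0 <= r.@[u]) <->
  (forall i, 0 <= u i) /\ 0 <= (slack R n).@[u].
Proof.
split=> [h|[h1 h2] r]; last by rewrite inE => /orP[/eqP->//|/mapP[i _ ->]]; rewrite mevalXU.
split=> [i|]; last by apply: h; rewrite inE eqxx.
by rewrite -(mevalXU u i); apply: h; rewrite inE; apply/orP; right; apply/mapP; exists i; rewrite ?mem_enum.
Qed.

Lemma simplex_box (R : realType) (n : nat) (u : 'I_n -> R) :
  (forall i, 0 <= u i) -> 0 <= (slack R n).@[u] -> in_box u.
Proof.
move=> u0 us i; rewrite u0 /=; move: us; rewrite meval_slack subr_ge0; apply: le_trans.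
by rewrite (bigD1 i) //= lerDl sumr_ge0.
Qed.

Lemma simplex_compact (R : realType) (n : nat) :
  compact [set x : 'rV[R]_n |
    forall r, r \in simplex_ineqs R n -> 0 <= r.@[x ord0]].
Proof.
have cbox : compact [set x : 'rV[R]_n | forall i, `[0, 1]%classic (x ord0 i)].
  by apply: (@rV_compact R n (fun=> `[0, 1]%classic)) => i; exact: segment_compact.
apply: (subclosed_compact _ cbox) => [|x /simplex_ineqsP[x0 xs] i]; last first.
  by rewrite /= in_itv /=; exact: simplex_box.
have -> : [set x : 'rV[R]_n | forall r, r \in simplex_ineqs R n -> 0 <= r.@[x ord0]] =
   \bigcap_(r in [set` simplex_ineqs R n])
      ((fun x : 'rV[R]_n => r.@[x ord0]) @^-1` [set y | 0 <= y]) by [].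
apply: closed_bigI => r _.
by have /continuous_closedP := @meval_continuous R n r; apply; exact: closed_ge.
Qed.

(** Three regions of the simplex, cut out with rho = 1 / (2 (L + 1)) and
    kappa = rho^D / 2. Where the slack is below rho, the ball constraint is at
    most -1/2 and its penalty alone is large. Where F is at most - kappa eps,
    the Łojasiewicz inequality makes some penalty at least a power of eps,
    which the factor eps^-a compensates. Elsewhere eps times the slack to the
    power D is at least 2 kappa eps. *)
Lemma penalty_lower_bound (R : realType) (n m D : nat) (L : R)
    (F : {mpoly R[n]}) (G : 'I_m.+1 -> {mpoly R[n]}) (e : 'I_m.+1 -> nat) :
  0 < L -> G ord0 = L%:MP - \sum_(i < n) 'X_i -> e ord0 = 1%N ->
  (msize F <= D.+1)%N -> (forall j, (msize (G j) <= (e j).+1)%N) ->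
  (forall y : 'I_n -> R, (forall i, 0 <= y i) ->
     (forall j, 0 <= (G j).@[y]) -> 0 <= F.@[y]) ->
  exists (kappa A : R) (a : nat), [/\ 0 < kappa, 0 < A &
    forall eps, 0 < eps <= 1 -> forall u : 'I_n -> R,
      (forall i, 0 <= u i) -> 0 <= (slack R n).@[u] ->
      kappa * eps <= (homogenize D F).@[u] + eps * (slack R n).@[u] ^+ D +
        A * eps^-1 ^+ a *
          \sum_j Num.max 0 (- (homogenize (e j) (G j)).@[u]) ^+ 2].
Proof.
move=> L0 G0 e0 FD Ge F0.
set hF := homogenize D F; pose hG j := homogenize (e j) (G j).
have hG0 u : (hG ord0).@[u] = (L + 1) * (slack R n).@[u] - 1.
  by rewrite /hG e0 G0 homogenize_ball.
have L10 : 0 < L + 1 by rewrite addr_gt0.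
have [|c1 [a [c10 loj]]] := lojasiewicz (p := hF) (q := hG) (@simplex_compact R n).
  move=> u /simplex_ineqsP[u0 us] hGu.
  have s0 : 0 < (slack R n).@[u].
    have := hGu ord0; rewrite hG0 => h.
    by rewrite -(pmulr_rgt0 _ L10); apply: lt_le_trans (ltr01) _; lra.
  rewrite /hF meval_homogenize // mulr_ge0 ?exprn_ge0 //.
  apply: F0 => [i|j]; first by rewrite divr_ge0.
  have := hGu j; rewrite /hG meval_homogenize // pmulr_rge0 ?exprn_gt0 //.
have [BF [BF0 hBF _]] := box_lipschitz_meval hF.
pose rho := (2 * (L + 1))^-1.
have rho0 : 0 < rho by rewrite invr_gt0 mulr_gt0.
have rho1 : rho <= 1 by rewrite invf_le1 ?mulr_gt0 //; lra.
pose kappa := rho ^+ D / 2.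
have k0 : 0 < kappa by rewrite divr_gt0 ?exprn_gt0.
have k1 : kappa <= 1.
  by rewrite ler_pdivrMr // mul1r (@le_trans _ _ 1) ?ler1n // exprn_ile1 ?(ltW rho0).
(* q eps^a is the violation that the Łojasiewicz inequality gives at
   t = kappa eps, and BF bounds |F| on the simplex. *)
pose q := c1 * kappa ^+ a.
have q0 : 0 < q by rewrite mulr_gt0 ?exprn_gt0.
pose A := (BF + 1) * (4 + (q ^+ 2)^-1).
have iq0 : 0 < (q ^+ 2)^-1 by rewrite invr_gt0 exprn_gt0.
have A0 : 0 < A by rewrite mulr_gt0 ?ltr_wpDl ?addr_gt0.
exists kappa, A, (2 * a)%N; split=> // eps /andP[eps0 eps1] u u0 us.
set S := \sum_j _; pose z := eps^-1; rewrite -/z.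
have z1 : 1 <= z by rewrite invf_ge1.
have z0 : 0 < z by rewrite invr_gt0.
have phiS j : Num.max 0 (- (hG j).@[u]) ^+ 2 <= S.
  by rewrite /S (bigD1 j) //= lerDl sumr_ge0 // => i _; rewrite exprn_ge0 // le_max lexx.
have S0 : 0 <= S by rewrite sumr_ge0 // => i _; rewrite exprn_ge0 // le_max lexx.
have zS0 : 0 <= A * z ^+ (2 * a) * S by exact: mulr_ge0 (mulr_ge0 (ltW A0) (exprn_ge0 _ (ltW z0))) S0.
have sD0 : 0 <= eps * (slack R n).@[u] ^+ D by rewrite mulr_ge0 ?exprn_ge0 ?(ltW eps0).
have hFu : - BF <= hF.@[u].
  have := hBF _ (simplex_box u0 us); rewrite ler_norml => /andP[] //.
have ke1 : kappa * eps <= 1 by rewrite mulr_ile1 // ?(ltW k0) ?(ltW eps0).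
have [us_rho|rho_us] := ltP (slack R n).@[u] rho.
  have hS : 4^-1 <= S.
    apply: le_trans (phiS ord0); rewrite hG0.
    have : (L + 1) * (slack R n).@[u] <= 1 / 2.
      have <- : (L + 1) * rho = 1 / 2 by rewrite /rho; field; rewrite gt_eqF.
      by rewrite ler_wpM2l ?(ltW L10) ?ltW.
    move=> h; have h' : 1 / 2 <= Num.max 0 (- ((L + 1) * (slack R n).@[u] - 1)).
      by rewrite le_max; apply/orP; right; lra.
    by rewrite expr2; nra.
  have hA : 4 * (BF + 1) <= A * z ^+ (2 * a).
    apply: (@le_trans _ _ A); last by rewrite ler_peMr ?(ltW A0) // exprn_ege1.
    by rewrite /A mulrC ler_wpM2l ?addr_ge0 // lerDl ltW.
  have : (4 * (BF + 1)) * 4^-1 <= A * z ^+ (2 * a) * S.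
    by apply: ler_pM => //; rewrite ?mulr_ge0 ?addr_ge0 ?invr_ge0.
  lra.
have [hFt|tF] := leP hF.@[u] (- (kappa * eps)).
  have t01 : 0 < kappa * eps <= 1 by rewrite mulr_gt0.
  have [j hj] := loj (kappa * eps) t01 u ((simplex_ineqsP u).2 (conj u0 us)) hFt.
  have hS : (q * eps ^+ a) ^+ 2 <= S.
    apply: le_trans (phiS j).
    have h : q * eps ^+ a <= Num.max 0 (- (hG j).@[u]).
      by rewrite le_max; apply/orP; right; rewrite /q -mulrA -exprMn lerNr ltW.
    have qe0 : 0 <= q * eps ^+ a by rewrite mulr_ge0 ?exprn_ge0 ?(ltW q0) ?(ltW eps0).
    by rewrite lerXn2r ?nnegrE // (le_trans qe0).
  have hA : (BF + 1) * (q ^+ 2)^-1 * z ^+ (2 * a) <= A * z ^+ (2 * a).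
    rewrite ler_wpM2r ?exprn_ge0 ?(ltW z0) // /A ler_wpM2l ?addr_ge0 //.
    by rewrite lerDr.
  have : (BF + 1) * (q ^+ 2)^-1 * z ^+ (2 * a) * (q * eps ^+ a) ^+ 2
      <= A * z ^+ (2 * a) * S.
    apply: ler_pM => //; last exact: exprn_ge0 (mulr_ge0 (ltW q0) (exprn_ge0 _ (ltW eps0))).
    apply: mulr_ge0 (exprn_ge0 _ (ltW z0)).
    by apply: mulr_ge0 (ltW iq0); exact: addr_ge0.
  have -> : (BF + 1) * (q ^+ 2)^-1 * z ^+ (2 * a) * (q * eps ^+ a) ^+ 2 = BF + 1.
    have E (b x y : R) : x != 0 -> y != 0 -> b * x^-1 * y^-1 * (x * y) = b.
      by move=> x0 y0; field; rewrite x0 y0.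
    rewrite /z exprVn [(q * _) ^+ 2]exprMn -exprM [(a * 2)%N]mulnC.
    by apply: E; rewrite expf_neq0 // gt_eqF.
  lra.
have : eps * (2 * kappa) <= eps * (slack R n).@[u] ^+ D.
  apply: ler_wpM2l; first exact: ltW.
  have -> : 2 * kappa = rho ^+ D by rewrite /kappa; field.
  by apply: lerXn2r; rewrite ?nnegrE ?(ltW rho0).
lra.
Qed.

Lemma bernstein_coef_ge0 (R : realType) (n N : nat) (h : ('I_n -> R) -> R) :
  (forall u, 0 <= h u) -> coef_ge0 (bernstein N h).
Proof. by move=> h0 g; rewrite mcoeff_bernstein mulr_ge0 ?weight_ge0. Qed.

Lemma msize_bernstein (R : realType) (n N : nat) (h : ('I_n -> R) -> R) :
  (msize (bernstein N h) <= N.+1)%N.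
Proof.
by apply: msize_coefP => g Ng; rewrite mcoeff_bernstein weight_eq0 ?mul0r.
Qed.

Lemma leq_add5 a b c d e N : (a + b + c + d + e < N)%N ->
  [/\ (a <= N)%N, (b <= N)%N, (c <= N)%N, (d <= N)%N & (e <= N)%N].
Proof. by move=> h; split; lia. Qed.

(** Take as multiplier of G_j the Bernstein polynomial of M max(0, - G_j), in
    the degree that makes the product of degree N. The Bernstein coefficients of
    the remainder are, up to O((1 + M) / N), the values at g / N of
    F + eps u_0^D + M sum_j max(0, - G_j)^2, which is at least kappa eps. So
    they are nonnegative once N exceeds a constant times a power of 1 / eps, and
    the remainder is a multiplier of the last generator. *)
Lemma cone_eventually (R : realType) (n m D : nat) (L : R)
    (F : {mpoly R[n]}) (G : 'I_m.+1 -> {mpoly R[n]}) :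
  0 < L -> G ord0 = L%:MP - \sum_(i < n) 'X_i -> G ord_max = 1 ->
  (msize F <= D.+1)%N ->
  (forall y : 'I_n -> R, (forall i, 0 <= y i) ->
     (forall j, 0 <= (G j).@[y]) -> 0 <= F.@[y]) ->
  exists (K : R) (c : nat), 0 < K /\
    forall eps, 0 < eps <= 1 -> forall N, K * eps^-1 ^+ c.+1 <= N%:R ->
      cone G N (simplex_form R n ^+ (N - D) * (F + eps%:MP)).
Proof.
move=> L0 G0 G1 FD F0.
(* Any bound on the degree of G_j will do, but the first one must be exactly 1:
   a larger one would multiply the ball constraint by the slack and hide its
   violation at infinity. *)
pose e j := maxn 1 (msize (G j)).-1.
have Ge j : (msize (G j) <= (e j).+1)%N.
  by rewrite /e; case: (msize (G j)) => // k; rewrite ltnS leq_maxr.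
have szG0 : (msize (G ord0) <= 2)%N.
  rewrite G0; apply: msizeD_leq; first by rewrite msizeC; case: eqP.
  by rewrite mmeasureN; apply: msize_sum_leq => i; rewrite msizeX mdeg1.
have e0 : e ord0 = 1%N.
  by apply/maxn_idPl; rewrite -subn1 leq_subLR.
have [kappa [A [a [k0 A0 Hpen]]]] := penalty_lower_bound L0 G0 e0 FD Ge F0.
pose phi j (u : 'I_n -> R) := Num.max 0 (- (homogenize (e j) (G j)).@[u]).
have phi0 j u : 0 <= phi j u by rewrite le_max lexx.
have tphi j : box_lipschitz (phi j) by apply: box_lipschitz_max0N; exact: box_lipschitz_meval.
have t1 : box_lipschitz (fun _ : 'I_n -> R => 1 : R) by exact: box_lipschitz_cst.
have s1 : (msize (1 : {mpoly R[n]}) <= D.+1)%N by rewrite mmeasure1.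
have [CA [NA [CA0 HA]]] := bernstein_approx_polyM FD t1 (bernstein_approx_simplex R n).
have [CE [NE [CE0 HE]]] := bernstein_approx_polyM s1 t1 (bernstein_approx_simplex R n).
have [CS [NS [CS0 HS]]] := bernstein_approx_sum (index_enum 'I_m.+1)
  (fun j => bernstein_approx_polyM (Ge j) (tphi j) (bernstein_approx_bernstein (phi j))).
(* N1 makes all the O(1/N) estimates valid and all the subtractions of degrees
   exact; Q collects the error constants. *)
pose N1 := (NA + NE + NS + D + \sum_j e j)%N.
pose Q := CA + CE + A * CS.
have Q0 : 0 <= Q by rewrite !addr_ge0 ?mulr_ge0 ?(ltW A0).
exists (Q / kappa + N1%:R + 1), a; split.
  by rewrite ltr_wpDl // addr_ge0 // divr_ge0 // ltW.
move=> eps eps01 N HN; have /andP[eps0 eps1] := eps01.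
set z := eps^-1 in HN; have z1 : 1 <= z by rewrite invf_ge1.
have z0 : 0 < z by rewrite invr_gt0.
have za1 k : 1 <= z ^+ k by rewrite exprn_ege1.
have Qk0 : 0 <= Q / kappa by rewrite divr_ge0 // ltW.
have N1N : N1%:R + 1 <= N%:R :> R.
  apply: le_trans HN; apply: (@le_trans _ _ (Q / kappa + N1%:R + 1)).
    by rewrite -addrA lerDr.
  by rewrite ler_peMr // addr_ge0 ?addr_ge0.
have {}N1N : (N1 < N)%N by rewrite -(ltr_nat R); lra.
have Npos : 0 < N%:R :> R by rewrite ltr0n (leq_trans _ N1N).
have [NAN NEN NSN DN eN'] := leq_add5 N1N.
have eN j : (e j <= N)%N.
  have : (e j <= \sum_j e j)%N by rewrite (bigD1 j) //= leq_addr.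
  by move=> /leq_trans; apply.
pose M := A * z ^+ a.
have M0 : 0 < M by rewrite mulr_gt0 ?exprn_gt0.
have QN : (CA + eps * CE + M * CS) / N%:R <= kappa * eps.
  rewrite ler_pdivrMr //.
  apply: (@le_trans _ _ (Q * z ^+ a)).
    rewrite /Q /M !mulrDl; apply: lerD; last by rewrite mulrAC.
    apply: lerD; first by rewrite ler_peMr.
    apply: (@le_trans _ _ CE); first by rewrite ler_piMl.
    by rewrite ler_peMr.
  have : Q / kappa * z ^+ a.+1 <= N%:R.
    apply: le_trans HN; rewrite ler_wpM2r ?exprn_ge0 ?(ltW z0) //.
    by rewrite -addrA lerDl addr_ge0.
  have ke0 : 0 < kappa * eps by rewrite mulr_gt0.
  rewrite -(ler_pM2l ke0) => h; apply: le_trans h.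
  by rewrite exprS le_eqVlt; apply/orP; left; apply/eqP; rewrite /z; field; rewrite !gt_eqF.
pose B j := bernstein (N - e j) (phi j).
pose P := F * simplex_form R n ^+ (N - D) + eps *: (1 * simplex_form R n ^+ (N - D)).
pose r := P - M *: (\sum_j G j * B j).
have PE : simplex_form R n ^+ (N - D) * (F + eps%:MP) = P.
  by rewrite /P mul1r mulrDr mulrC; congr (_ + _); rewrite mulrC mul_mpolyC.
have -> : simplex_form R n ^+ (N - D) * (F + eps%:MP) = r + \sum_j (M *: B j) * G j.
  rewrite PE /r scaler_sumr.
  under [X in _ = _ + X]eq_bigr => j _ do rewrite -scalerAl [B j * _]mulrC.
  by rewrite subrK.
have szB j : (msize (M *: B j * G j) <= N.+1)%N.
  rewrite -[X in (_ <= X.+1)%N](subnK (eN j)); apply: msizeM_leq => //.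
  by rewrite (leq_trans (msizeZ_le _ _)) // msize_bernstein.
apply: coneD; last first.
  apply: cone_sum => j; apply: cone_term => //.
  by apply: coef_ge0Z; rewrite ?(ltW M0) //; exact: bernstein_coef_ge0.
apply: cone_coef_ge0 => //; last first.
  apply: msizeD_leq.
    rewrite -PE -[X in (_ <= X.+1)%N](subnK DN); apply: msizeM_leq; first exact: msize_simplex_exp.
    by apply: msizeD_leq => //; rewrite msizeC; case: eqP.
  rewrite mmeasureN scaler_sumr; apply: msize_sum_leq => j.
  by rewrite mulrC scalerAl.
move=> g.
have hA := HA N NAN g; have hE := HE N NEN g; have hS := HS N NSN g.
have [gN|Ng] := leqP (mdeg g) N; last first.
  move: hA hE hS; rewrite (weight_eq0 _ Ng) !mul0r !subr0 !normr_le0.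
  rewrite /r /P mcoeffB mcoeffD !mcoeffZ => /eqP -> /eqP -> /eqP ->.
  by rewrite !mulr0 addr0 subr0.
have bx := grid_point_box R gN.
have u0 i : 0 <= grid_point R N g i by have /andP[] := bx i.
have us : 0 <= (slack R n).@[grid_point R N g].
  by rewrite slack_grid ?divr_ge0 ?subr_ge0 ?ler_nat // -(ltr0n R).
have := Hpen eps eps01 _ u0 us; rewrite -/z -/M.
rewrite homogenize1 rmorphXn /= mulr1 in hE.
rewrite mulr1 in hA.
set u := grid_point R N g in hA hE hS *; set w := weight R N g in hA hE hS.
have w0 : 0 <= w by exact: weight_ge0.
pose S2 := \sum_j Num.max 0 (- (homogenize (e j) (G j)).@[u]) ^+ 2.
have phiE : \sum_j (homogenize (e j) (G j)).@[u] * phi j u = - S2.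
  rewrite -sumrN; apply: eq_bigr => j _; rewrite /phi.
  by case: leP => _; rewrite ?mulr0 ?expr0n ?oppr0 // mulrN sqrrN expr2.
rewrite phiE in hS; rewrite -/S2 => hpen.
rewrite /r /P mcoeffB mcoeffD !mcoeffZ.
move: hA hE hS; set cA := mcoeff _ _; set cE := mcoeff _ _; set cS := mcoeff _ _.
rewrite !ler_norml => /andP[hA _] /andP[hE _] /andP[_ hS].
have : w * ((CA + eps * CE + M * CS) / N%:R) <=
    w * ((homogenize D F).@[u] + eps * (slack R n).@[u] ^+ D + M * S2).
  by apply: ler_wpM2l => //; exact: le_trans hpen.
have hE' := ler_wpM2l (ltW eps0) hE.
have hS' := ler_wpM2l (ltW M0) hS.
move: hA hE' hS'; rewrite !mulrDl !mulrDr !mulrN.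
lra.
Qed.

(** * Substitution of squares for the variables *)

Definition square_vars (R : realType) (n : nat) (p : {mpoly R[n]}) : {mpoly R[n]} :=
  p \mPo [tuple 'X_i ^+ 2 | i < n].

Lemma square_varsX (R : realType) (n : nat) (m : 'X_{1..n}) :
  square_vars ('X_[m] : {mpoly R[n]}) = 'X_[m *+ 2].
Proof.
rewrite /square_vars comp_mpolyX [RHS]mpolyXE_id; apply: eq_bigr => i _.
by rewrite tnth_mktuple mulmnE mulnC exprM.
Qed.

Lemma square_varsM (R : realType) (n : nat) (p q : {mpoly R[n]}) :
  square_vars (p * q) = square_vars p * square_vars q.
Proof. exact: rmorphM. Qed.

Lemma square_vars_sum (R : realType) (n : nat) (I : Type) (r : seq I)
    (F : I -> {mpoly R[n]}) :
  square_vars (\sum_(i <- r) F i) = \sum_(i <- r) square_vars (F i).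
Proof. exact: raddf_sum. Qed.

Lemma square_vars_simplex (R : realType) (n k : nat) :
  square_vars (simplex_form R n ^+ k) = (1 + sqnorm R n) ^+ k.
Proof.
rewrite /square_vars rmorphXn /= comp_mpolyD comp_mpoly1; congr ((1 + _) ^+ k).
rewrite -/(square_vars _) square_vars_sum; apply: eq_bigr => i _.
by rewrite square_varsX mpolyXn.
Qed.

Lemma mulm2_inj (n : nat) : injective (fun m : 'X_{1..n} => (m *+ 2)%MM).
Proof.
move=> m m' /mnmP E; apply/mnmP => i.
by have := E i; rewrite !mulmnE => /eqP; rewrite eqn_pmul2r // => /eqP.
Qed.

Lemma mcoeff_square_vars (R : realType) (n : nat) (p : {mpoly R[n]}) (m : 'X_{1..n}) :
  (square_vars p)@_(m *+ 2) = p@_m.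
Proof.
elim/mpolyind: p => [|c b p _ _ IH]; first by rewrite /square_vars comp_mpoly0 !mcoeff0.
rewrite /square_vars comp_mpolyD comp_mpolyZ -!/(square_vars _) square_varsX.
by rewrite !mcoeffD !mcoeffZ IH !mcoeffX (inj_eq (@mulm2_inj n)).
Qed.

Lemma mcoeff_square_vars_odd (R : realType) (n : nat) (p : {mpoly R[n]})
    (g : 'X_{1..n}) i : odd (g i) -> (square_vars p)@_g = 0.
Proof.
move=> og; elim/mpolyind: p => [|c b p _ _ IH]; first by rewrite /square_vars comp_mpoly0 !mcoeff0.
rewrite /square_vars comp_mpolyD comp_mpolyZ -!/(square_vars _) square_varsX.
rewrite !mcoeffD !mcoeffZ IH mcoeffX; case: eqP => [E|_]; last by rewrite mulr0 addr0.
by move: og; rewrite -E mulmnE oddM andbF.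
Qed.

Lemma mnm_parity (n : nat) (g : 'X_{1..n}) :
  (exists m, g = (m *+ 2)%MM) \/ exists i, odd (g i).
Proof.
have [/existsP[i og]|] := boolP [exists i, odd (g i)]; first by right; exists i.
rewrite negb_exists => /forallP ev; left; exists [multinom (g i)./2 | i < n].
by apply/mnmP => i; rewrite mulmnE mnmE muln2 even_halfK // ev.
Qed.

Lemma mcoeff_sign_flip (R : realType) (n : nat) (i : 'I_n) (p : {mpoly R[n]})
    (g : 'X_{1..n}) : (sign_flip i p)@_g = (-1) ^+ g i * p@_g.
Proof.
have flipX b : sign_flip i ('X_[b] : {mpoly R[n]}) = (-1) ^+ b i *: 'X_[b].
  rewrite /sign_flip comp_mpolyX -mul_mpolyC rmorphXn /= mpolyCN mpolyC1.
  rewrite [X in _ = _ * X]mpolyXE_id.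
  rewrite (bigD1 i) //= [in RHS](bigD1 i) //= tnth_mktuple eqxx exprNn -mulrA.
  congr (_ * (_ * _)); apply: eq_bigr => j ji.
  by rewrite tnth_mktuple (negPf ji).
elim/mpolyind: p => [|c b p _ _ IH]; first by rewrite /sign_flip comp_mpoly0 !mcoeff0 mulr0.
rewrite /sign_flip comp_mpolyD comp_mpolyZ -!/(sign_flip _ _) flipX.
rewrite !mcoeffD !mcoeffZ IH mcoeffX mulrDr; congr (_ + _).
by case: eqP => [->|_]; rewrite ?mulr0 // !mulr1 mulrC.
Qed.

Lemma even_mpoly_coef (R : realType) (n : nat) (p : {mpoly R[n]})
    (g : 'X_{1..n}) i : even_mpoly p -> odd (g i) -> p@_g = 0.
Proof.
move=> /(_ i)/(congr1 (mcoeff g)) E og; move: E.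
rewrite mcoeff_sign_flip -signr_odd og expr1 mulN1r => E; lra.
Qed.

(** The inverse of square_vars on even polynomials, y being substituted for the
    squares. *)
Definition half_vars (R : realType) (n : nat) (p : {mpoly R[n]}) : {mpoly R[n]} :=
  \sum_(b : 'X_{1..n < msize p}) p@_(b *+ 2) *: 'X_[b].

Lemma mcoeff_half_vars (R : realType) (n : nat) (p : {mpoly R[n]}) (b : 'X_{1..n}) :
  (half_vars p)@_b = p@_(b *+ 2).
Proof.
have [bp|pb] := ltnP (mdeg b) (msize p).
  exact: (mcoeff_mpoly (fun b => p@_(b *+ 2))).
rewrite [RHS](coef_msize0 (leqnn _)); last by rewrite mdegMn (leq_trans pb) ?leq_pmulr.
rewrite /half_vars raddf_sum /= big1 // => m _; rewrite mcoeffZ mcoeffX.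
case: eqP => [E|]; last by rewrite mulr0.
by have := bmdeg m; rewrite E ltnNge pb.
Qed.

Lemma half_varsK (R : realType) (n : nat) (p : {mpoly R[n]}) :
  even_mpoly p -> square_vars (half_vars p) = p.
Proof.
move=> ep; apply/mpolyP => g; have [[m ->]|[i og]] := mnm_parity g.
  by rewrite mcoeff_square_vars mcoeff_half_vars.
by rewrite (mcoeff_square_vars_odd _ og) (even_mpoly_coef ep og).
Qed.

Lemma square_varsK (R : realType) (n : nat) (p : {mpoly R[n]}) :
  half_vars (square_vars p) = p.
Proof.
by apply/mpolyP => g; rewrite mcoeff_half_vars mcoeff_square_vars.
Qed.

Lemma msize_half_vars (R : realType) (n : nat) (p : {mpoly R[n]}) :
  (msize (half_vars p) <= half_degS p)%N.
Proof.
apply: msize_coefP => b hb; rewrite mcoeff_half_vars.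
apply: (coef_msize0 (leqnn _)); rewrite mdegMn.
move: hb; rewrite /half_degS /tdeg; set s := mmeasure _ _; move: (mdeg b) => d.
clearbody s; lia.
Qed.

Lemma tdeg_square_vars (R : realType) (n N : nat) (p : {mpoly R[n]}) :
  (msize p <= N.+1)%N -> (tdeg (square_vars p) <= 2 * N)%N.
Proof.
move=> pN; suff : (msize (square_vars p) <= (2 * N).+1)%N.
  by rewrite /tdeg; case: (mmeasure _ _).
apply: msize_coefP => g; have [[m ->]|[i og] _] := mnm_parity g; last first.
  exact: mcoeff_square_vars_odd og.
rewrite mcoeff_square_vars mdegMn mulnC ltn_pmul2r // => Nm.
exact: coef_msize0 pN Nm.
Qed.

(** A term a y^m with a >= 0 becomes the square of sqrt(a) x^m. *)
Lemma sum_of_monomial_squares_square_vars (R : realType) (n : nat)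
    (p : {mpoly R[n]}) :
  coef_ge0 p -> sum_of_monomial_squares (square_vars p).
Proof.
move=> p0; exists [seq (Num.sqrt p@_m *: 'X_[m]) ^+ 2 | m <- msupp p]; split.
  by move=> q /mapP[m _ ->]; exists (Num.sqrt p@_m), m.
rewrite big_map [in LHS](mpolyE p) square_vars_sum; apply: eq_bigr => m _.
rewrite /square_vars comp_mpolyZ -/(square_vars _) square_varsX.
by rewrite exprZn sqr_sqrtr ?p0 // mpolyXn.
Qed.

Lemma meval_square_vars (R : realType) (n : nat) (p : {mpoly R[n]}) (v : 'I_n -> R) :
  (square_vars p).@[v] = p.@[fun i => v i ^+ 2].
Proof.
rewrite /square_vars comp_mpoly_meval; apply: meval_eq => i.
by rewrite tnth_mktuple rmorphXn /= mevalXU.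
Qed.

Lemma certificate_of_cone (R : realType) (n m : nat)
    (g G : 'I_m.+1 -> {mpoly R[n]}) (f F : {mpoly R[n]}) (eps : R) (k : nat) :
  (forall j, square_vars (G j) = g j) -> square_vars F = f ->
  cone G (k + half_degS f) (simplex_form R n ^+ k * (F + eps%:MP)) ->
  certificate g f eps k.
Proof.
move=> Gg Ff [s [s0 sN E]]; exists (fun j => square_vars (s j)); split; last split.
- by move=> j; exact: sum_of_monomial_squares_square_vars.
- by move=> j; rewrite -Gg -square_varsM; exact: tdeg_square_vars.
- have := congr1 (@square_vars R n) E.
  rewrite square_varsM square_vars_simplex square_vars_sum.
  rewrite {1}/square_vars comp_mpolyD comp_mpolyC -/(square_vars F) Ff => ->.
  by apply: eq_bigr => j _; rewrite square_varsM Gg.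
Qed.

(** For large eps the certificate exists with no multiplication by a power of
    1 + |y|, and for eps between 1 and the threshold C it is deduced from the
    one for 1. The factor C^(c+1) in the bound keeps k large enough there,
    although eps^-c is small. *)
Lemma cone_effective (R : realType) (n m D : nat) (L : R)
    (F : {mpoly R[n]}) (G : 'I_m.+1 -> {mpoly R[n]}) :
  0 < L -> G ord0 = L%:MP - \sum_(i < n) 'X_i -> G ord_max = 1 ->
  (msize F <= D.+1)%N ->
  (forall y : 'I_n -> R, (forall i, 0 <= y i) ->
     (forall j, 0 <= (G j).@[y]) -> 0 <= F.@[y]) ->
  exists (K : R) (c : nat), 0 < K /\
    forall eps, 0 < eps -> forall k, K * eps^-1 ^+ c.+1 <= k%:R ->
      cone G (k + D) (simplex_form R n ^+ k * (F + eps%:MP)).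
Proof.
move=> L0 G0 G1 FD F0.
have [C0 HC0] := cone_archimedean L0 G0 G1 FD.
have [K [c [K0 HK]]] := cone_eventually L0 G0 G1 FD F0.
pose C := Num.max 1 C0.
have C1 : 1 <= C by rewrite le_max lexx.
have Cp : 0 < C := lt_le_trans ltr01 C1.
exists (K * C ^+ c.+1), c; split=> [|eps eps0 k hk].
  by rewrite mulr_gt0 ?exprn_gt0.
have [Ceps|epsC] := leP C eps.
  by apply: cone_simplexM; apply: HC0; apply: le_trans Ceps; rewrite le_max lexx orbT.
pose e := Num.min eps 1.
have e0 : 0 < e by rewrite lt_min eps0 ltr01.
have eC : e^-1 <= C * eps^-1.
  rewrite /e; case: (leP eps 1) => _; first by apply: ler_peMl => //; rewrite invr_ge0 ltW.
  by rewrite invr1 ler_pdivlMr // mul1r ltW.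
have -> : simplex_form R n ^+ k * (F + eps%:MP) =
    simplex_form R n ^+ (k + D - D) * (F + e%:MP) +
      (eps - e) *: simplex_form R n ^+ k.
  rewrite addnK -mul_mpolyC mpolyCB; ring.
apply: coneD; last first.
  apply: coneZ; first by rewrite subr_ge0 /e ge_min lexx.
  apply: cone_coef_ge0 => //; first by apply: coef_ge0_exp; exact: coef_ge0_simplex.
  by rewrite (leq_trans (msize_simplex_exp _ _ _)) // ltnS leq_addr.
apply: HK; first by rewrite e0 /e ge_min lexx orbT.
apply: le_trans (_ : k%:R <= _); last by rewrite ler_nat leq_addr.
apply: le_trans hk; rewrite -mulrA ler_wpM2l ?(ltW K0) // -exprMn.
by rewrite lerXn2r ?nnegrE ?invr_ge0 ?mulr_ge0 ?(ltW e0) ?(ltW Cp) ?invr_ge0 ?(ltW eps0).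
Qed.

Theorem theorem1 (R : realType) (n m : nat) (g : 'I_m.+1 -> {mpoly R[n]})
    (L : R) (f : {mpoly R[n]})
    (g_even : forall j : 'I_m.+1, even_mpoly (g j))
    (L_gt0 : 0 < L)
    (g_first : g ord0 = L%:MP - sqnorm R n)
    (g_last : g ord_max = 1)
    (f_even : even_mpoly f)
    (f_ge0 : forall x : 'rV[R]_n, semialg g x -> 0 <= f.@[x ord0]) :
  (forall eps : R, 0 < eps ->
     exists K : nat, forall k : nat, (K <= k)%N -> certificate g f eps k) /\
  ((semialg g)° !=set0 ->
     exists cbar c : R, 0 < cbar /\ 0 < c /\
       forall eps : R, 0 < eps ->
         forall k : nat, cbar * eps `^ (- c) <= k%:R -> certificate g f eps k).
Proof.
pose G j := half_vars (g j); pose F := half_vars f.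
have Gg j : square_vars (G j) = g j by exact: half_varsK.
have Ff : square_vars F = f by exact: half_varsK.
have G0 : G ord0 = L%:MP - \sum_(i < n) 'X_i.
  rewrite /G g_first -[RHS]square_varsK; congr half_vars.
  rewrite /square_vars comp_mpolyB comp_mpolyC -/(square_vars _) square_vars_sum.
  by congr (_ - _); apply: eq_bigr => i _; rewrite square_varsX mpolyXn.
have G1 : G ord_max = 1.
  by rewrite /G g_last -[RHS]square_varsK /square_vars comp_mpoly1.
have FD : (msize F <= (half_degS f).+1)%N by apply: leqW; exact: msize_half_vars.
have F0 (y : 'I_n -> R) : (forall i, 0 <= y i) ->
    (forall j, 0 <= (G j).@[y]) -> 0 <= F.@[y].
  move=> y0 Gy; pose x : 'rV[R]_n := \row_i Num.sqrt (y i).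
  have E p : (square_vars p).@[x ord0] = p.@[y].
    by rewrite meval_square_vars; apply: meval_eq => i; rewrite mxE sqr_sqrtr.
  by rewrite -E Ff; apply: f_ge0 => j; rewrite -Gg E.
have [K [c [K0 H]]] := cone_effective L_gt0 G0 G1 FD F0.
split=> [eps eps0|_].
  exists (Num.bound (K * eps^-1 ^+ c.+1)) => k hk.
  apply: (certificate_of_cone Gg Ff); apply: H => //.
  apply: ltW; apply: lt_le_trans (archi_boundP _) _; last by rewrite ler_nat.
  by rewrite mulr_ge0 ?exprn_ge0 ?invr_ge0 ?(ltW K0) ?(ltW eps0).
exists K, c.+1%:R; split=> //; split=> // eps eps0 k hk.
apply: (certificate_of_cone Gg Ff); apply: H => //.
by rewrite exprVn -powR_mulrn ?(ltW eps0) // -powRN.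
Qed.
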